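(* Let $F/\mathbb{F}_q(T)$ be a finite extension. Let $\psi\in F[x]$ be a Drinfeld-Lattès map, i.e. suppose there are a linearized polynomial $\phi_T=\sum_{i=0}^r\phi_i x^{q^i}\in\overline{F}[x]$ with $r\ge 1$ and $\phi_0\phi_r\neq 0$, a point $\delta\in\overline{F}$ that is preperiodic for $\phi_T$, and a rational function $f\in\overline{F}(x)$ of positive degree such that $f\circ(\phi_T+\delta)=\psi\circ f$ as maps $\mathbb{P}^1_{\overline{F}}\to\mathbb{P}^1_{\overline{F}}$. Let $\alpha\in\overline{F}$ be a point that is not a pole of $f$, and let $\beta=f(\alpha)$. Then the following are equivalent: (1) $G_\infty(\phi_T,\alpha)$ is virtually abelian. (2) $G_\infty(\phi_T+\delta,\alpha)$ is virtually abelian. (3) $G_\infty(\psi,\beta)$ is virtually abelian.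
   Context: $\phi_T+\delta$ denotes the polynomial map $x\mapsto \phi_T(x)+\delta$. For a rational map $h$ and a point $a$ defined over a field $E$, $h^{-\infty}(a)=\bigcup_{n\ge0}h^{-n}(a)$ is the set of all iterated preimages of $a$ in $\mathbb{P}^1(\overline{E})$, and $G_\infty(h,a)=\mathrm{Gal}(E(h^{-\infty}(a))/E)$, where the field is generated by the finite points. A group is virtually abelian if it has an abelian subgroup of finite index (for profinite groups: an open abelian subgroup). Since the objects are only defined over $\overline{F}$, the groups $G_\infty$ are taken over a finite extension of $F$ over which $\phi_T,f,\delta,\alpha$ (hence $\beta$) are all defined; virtual abelianity does not change when passing to a further finite extension. A point is preperiodic for a map if its forward orbit is finite. *)

(* Defs.v *)
From HB Require Import structures.
From mathcomp Require Import all_boot all_order all_algebra.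
From mathcomp Require Import boolp classical_sets cardinality.
Set Implicit Arguments.
Unset Strict Implicit.
Unset Printing Implicit Defensive.
Import GRing.Theory.
Local Open Scope ring_scope.
Local Open Scope quotient_scope.

(* K-points of the projective line; [None] is the point at infinity. *)
Definition P1 (K : Type) := option K.

Section RationalMaps.
Variable K : fieldType.
Implicit Type f : {fraction {poly K}}.

(* The representative of a fraction need not be reduced, so the gcd is divided
   out; the reduced pair is determined up to a common nonzero scalar. *)
Definition redgcd f : {poly K} := gcdp \n_(repr f) \d_(repr f).
Definition rnum f : {poly K} := \n_(repr f) %/ redgcd f.
Definition rden f : {poly K} := \d_(repr f) %/ redgcd f.

Definition ratdeg f : nat := (maxn (size (rnum f)) (size (rden f))).-1.

(* At infinity, in the non-polar case, the value is the quotient of the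
   coefficients of degree [deg (rden f)]. *)
Definition ratmap f (x : P1 K) : P1 K :=
  let p := rnum f in let q := rden f in
  match x with
  | Some a => if q.[a] == 0 then None else Some (p.[a] / q.[a])
  | None => if (size q < size p)%N then None
            else Some (p`_(size q).-1 / lead_coef q)
  end.

Definition polmap (p : {poly K}) : {fraction {poly K}} := FracField.tofrac p.

Definition backward_orbit f (a : P1 K) : set (P1 K) :=
  [set x | exists n : nat, iter n (ratmap f) x = a]%classic.

Definition preperiodic f (a : P1 K) : Prop :=
  finite_set [set iter n (ratmap f) a | n in [set: nat]]%classic.

End RationalMaps.

(* [E] is regarded as a subfield of [K] by means of [j]. *)
Section OverSubfield.
Variables (E K : fieldType) (j : {rmorphism E -> K}).

Definition point_over (a : K) : Prop := exists e : E, a = j e.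

Definition poly_over (p : {poly K}) : Prop :=
  exists p0 : {poly E}, p = map_poly j p0.

Definition rat_over (f : {fraction {poly K}}) : Prop :=
  exists p0 q0 : {poly E},
    q0 != 0 /\ f = polmap (map_poly j p0) / polmap (map_poly j q0).

Definition adjoin_pred (S : set K) : {pred K} := fun x =>
  `[< forall M : {pred K}, divring_closed M ->
        (forall e : E, j e \in M) -> (forall y : K, S y -> y \in M) ->
        x \in M >].

Fact adjoin_divring_closed S : divring_closed (adjoin_pred S).
Proof.
split.
- by apply/asboolP => M [].
- move=> x y /asboolP hx /asboolP hy; apply/asboolP => M hM hE hS.
  by case: (hM) => _ + _; apply; [exact: hx | exact: hy].
- move=> x y /asboolP hx /asboolP hy; apply/asboolP => M hM hE hS.
  by case: (hM) => _ _; apply; [exact: hx | exact: hy].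
Qed.

HB.instance Definition _ S :=
  GRing.isDivringClosed.Build K (adjoin_pred S) (adjoin_divring_closed S).

(* The field E(S) generated in [K] by the image of [E] and by [S]. *)
Record adjoin (S : set K) :=
  Adjoin { adjoin_val : K; _ : adjoin_val \in adjoin_pred S }.

HB.instance Definition _ S := [isSub for @adjoin_val S].
HB.instance Definition _ S := [Choice of adjoin S by <:].
HB.instance Definition _ S :=
  [SubChoice_isSubIntegralDomain of adjoin S by <:].
HB.instance Definition _ S :=
  [SubIntegralDomain_isSubField of adjoin S by <:].

(* Gal(E(S)/E): all field automorphisms of E(S) that fix [E] pointwise. No
   separability of E(S)/E is assumed. *)
Definition galois_group (S : set K) : set (adjoin S -> adjoin S) :=
  [set s | [/\ zmod_morphism s, monoid_morphism s, bijective s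
             & forall (x : adjoin S) (e : E), val x = j e -> s x = x]]%classic.

Definition Ginfty (h : {fraction {poly K}}) (a : P1 K) :=
  @galois_group [set x : K | backward_orbit h a (Some x)]%classic.

End OverSubfield.

Arguments Ginfty {E K} j h a.

(* [G] is meant to be a group of permutations of [L] under composition, with
   the topology of pointwise convergence for the discrete topology on [L]; on
   a Galois group this is the Krull topology. *)
Section VirtuallyAbelian.
Variables (L : eqType) (G : set (L -> L)).

Definition is_subgroup (H : set (L -> L)) : Prop :=
  [/\ (H `<=` G)%classic, H idfun,
      forall s t, H s -> H t -> H (s \o t)
    & forall s, H s -> exists t, [/\ H t, cancel s t & cancel t s]].

Definition is_open (U : set (L -> L)) : Prop :=
  forall s, U s -> exists xs : seq L,
    forall t, G t -> {in xs, t =1 s} -> U t.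

Definition is_abelian (H : set (L -> L)) : Prop :=
  forall s t, H s -> H t -> s \o t =1 t \o s.

Definition virtually_abelian : Prop :=
  exists H, [/\ is_subgroup H, is_open H & is_abelian H].

End VirtuallyAbelian.

Definition linearized_poly (K : fieldType) (q r : nat) (c : 'I_r.+1 -> K) :
  {poly K} := \sum_(i < r.+1) c i *: 'X^(q ^ i).

(* Main.v *)
Require Import Defs.
From mathcomp Require Import all_boot all_order all_algebra fieldext.
From HB Require Import structures.
From mathcomp Require Import separable finfield zify.
From mathcomp Require Import boolp classical_sets cardinality.
Set Implicit Arguments.
Unset Strict Implicit.
Unset Printing Implicit Defensive.
Import Order.TTheory GRing.Theory Num.Theory.
Local Open Scope ring_scope.

(** Write K for the algebraic closure, L for the additive polynomial, g = L + delta, and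
    S(h, a) for the set of iterated preimages of a under h.

    Galois groups.  Embeddings over E of subfields of K extend to automorphisms of K, and
    Aut(K/E) is compact.  Therefore, for a set S stable under Aut(K/E), the group
    Gal(E(S)/E) is virtually abelian if and only if there is a finite set W in K such that
    the automorphisms over E that fix W commute with each other on S
    ([virtually_abelianP]).  As W need not lie in E(S), finite extensions of E are absorbed
    in W, and only points of different sets S have to be compared.

    (1) <-> (2).  If L(w) + delta = w, translation by w conjugates L to g.  With delta, the
    point w is preperiodic for L, so that for every n it is the sum of a value of L^n on its
    finite orbit and of a torsion point; and torsion points of L are differences of points
    of S(L, alpha).  So each point of S(g, alpha) is an integral combination of points of
    S(L, alpha) and of finitely many constants, and conversely ([backward_translate]).

    Structure of f.  On the affine line g is onto and not injective, so no finite nonempty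
    set is completely invariant under g; hence f has no finite pole and is a polynomial
    ([semiconj_polynomial]).  The heart of the proof is [semiconjugacy_structure]: if
    f o g = psi o f, then f = a (A - c)^e + b with A additive, e prime to p and A o g again
    of the form (additive + constant) o A.  Frobenius and the quotient by the finite group
    of translations that preserve f are additive and can be split off from f, so f may be
    assumed separable and without translation symmetry.  For affine l, the polynomial
    f(l(x) + eps) - f(x) divides f(g(l(x)) + L(eps)) - f(g(x)).  Because L(eps) has a linear
    term, passing from the first polynomial to the second multiplies the slopes of small
    roots eps at x = infinity by deg g, so the least positive slope of the first is missing
    from the second and cannot have been a slope at all ([semiconj_no_edge]).  For l a
    translation, this shows that f' has larger degree than all higher divided derivatives
    ([deriv_strict_max]); the identity f'(g) L' = psi'(f) f', where L' is constant, then
    excludes that p divides deg f ([deg_coprime]).  For l a rotation by a root of unity of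
    order dividing deg f, it shows that f, suitably centred, is preserved by l, and f is
    a (X - c)^d + b ([tame_power_form]).

    (2) <-> (3).  Put w = A - c.  Then w o g = h o w for a map h that commutes with the
    e-th roots of unity, and f(x) = f(y) means that w(x)^e = w(y)^e.  A point of
    S(psi, f(alpha)) is f(x) for some x that, after a rotation of w(x) and a translation of x
    by the finite group ker A, is an integral combination of points of S(g, alpha)
    ([virtually_commuting_push]).  Conversely, let an automorphism fix f(S(g, alpha)) and
    suitable constants.  It multiplies each w(x) by a root of unity, which is trivial by
    induction along the backward orbit, so it moves x by an element of ker A; these elements
    form a system that is compatible under L and starts at 0, and ker A is finite, so they
    vanish.  Applied to commutators, this gives [virtually_commuting_lift]. *)

(** * Extending partial automorphisms of an algebraically closed field *)

Lemma rmorphism_of (R S : nzRingType) (s : R -> S) :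
  zmod_morphism s -> monoid_morphism s -> exists sg : {rmorphism R -> S}, sg =1 s.
Proof.
move=> sZ sM.
pose a := GRing.isZmodMorphism.Build _ _ s sZ.
pose b := GRing.isMonoidMorphism.Build _ _ s sM.
pose sg : {rmorphism R -> S} := HB.pack s a b.
by exists sg.
Qed.

Section Automorphisms.
Variables (E : fieldType) (K : closedFieldType) (j : {rmorphism E -> K}).
Hypothesis algE : forall x : K, exists2 q : {poly E}, q != 0 & root (map_poly j q) x.

Definition fixes (s : K -> K) := forall e, s (j e) = j e.

Section PartialHom.
Implicit Types (G : set (K * K)).

(** The graph of a ring homomorphism over E from a subring of K to K.  Graphs make unions of
    chains and one-point extensions immediate, without building the subrings as types. *)
Record partial_hom G : Prop := PartialHom {
  ph_base : forall e, G (j e, j e);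
  ph_sub : forall x y x' y', G (x, y) -> G (x', y') -> G (x - x', y - y');
  ph_mul : forall x y x' y', G (x, y) -> G (x', y') -> G (x * x', y * y');
  ph_fun : forall y, G (0, y) -> y = 0 }.

Variables (G : set (K * K)) (hG : partial_hom G).

Lemma ph0 : G (0, 0). Proof. by rewrite -(rmorph0 j); exact: ph_base. Qed.

Lemma ph1 : G (1, 1). Proof. by rewrite -(rmorph1 j); exact: ph_base. Qed.

Lemma ph_add x y x' y' : G (x, y) -> G (x', y') -> G (x + x', y + y').
Proof.
move=> h h'; rewrite -[x']opprK -[y']opprK; apply: (ph_sub hG) => //.
by rewrite -[- x']add0r -[- y']add0r; apply: (ph_sub hG) => //; exact: ph0.
Qed.

Lemma ph_sum (I : finType) (F F' : I -> K) :
  (forall i, G (F i, F' i)) -> G (\sum_i F i, \sum_i F' i).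
Proof.
move=> h; elim/big_rec2: _ => [|i x y _ h']; first exact: ph0.
exact: ph_add.
Qed.

Lemma ph_exp x y n : G (x, y) -> G (x ^+ n, y ^+ n).
Proof.
move=> h; elim: n => [|n IH]; first by rewrite !expr0; exact: ph1.
by rewrite !exprS; apply: (ph_mul hG).
Qed.

(** If x <> 0 then x is a root of a polynomial over E with nonzero constant term, and its image
    is a root of the same polynomial. *)
Lemma ph_inj x : G (x, 0) -> x = 0.
Proof.
move=> Gx; apply/eqP; apply/negPn/negP => x0.
have [q q0 rq] := algE x; move: {2}(size q) (leqnn (size q)) => n.
elim: n q q0 rq => [|n IH] q q0 rq sq.
  by move: q0; rewrite -size_poly_eq0 -leqn0 sq.
have hq : G ((map_poly j q).[x], (map_poly j q).[0]).
  rewrite !horner_coef; apply: ph_sum => i; apply: (ph_mul hG).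
    by rewrite coef_map; exact: ph_base.
  exact: ph_exp.
rewrite (rootP rq) in hq; have /eqP := ph_fun hG hq.
have -> : (map_poly j q).[0] = j q.[0] by rewrite -horner_map rmorph0.
rewrite fmorph_eq0 => /factor_theorem[q1]; rewrite subr0 => eq.
have q10 : q1 != 0 by apply: contraNneq q0 => e; rewrite eq e mul0r.
apply: (IH q1) => //; last first.
  by move: sq; rewrite eq size_mulX.
move: rq; rewrite eq rmorphM /= map_polyX /root hornerM hornerX mulf_eq0 (negPf x0) orbF.
by [].
Qed.

Definition ph_poly (p q : {poly K}) := forall i, G (p`_i, q`_i).

Lemma ph_poly_size p q : ph_poly p q -> size p = size q.
Proof.
move=> h; apply/eqP; rewrite eqn_leq; apply/andP; split; apply/leq_sizeP => i hi.
  by apply: ph_inj; have := h i; rewrite [q`_i]nth_default.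
by apply: (ph_fun hG); have := h i; rewrite [p`_i]nth_default.
Qed.

Lemma ph_polyC x y : G (x, y) -> ph_poly x%:P y%:P.
Proof. by move=> h i; rewrite !coefC; case: ifP => // _; exact: ph0. Qed.

Lemma ph_polyX : ph_poly 'X 'X.
Proof. by move=> i; rewrite !coefX; case: eqP => _; [exact: ph1 | exact: ph0]. Qed.

Lemma ph_polyB p q p' q' : ph_poly p q -> ph_poly p' q' -> ph_poly (p - p') (q - q').
Proof. by move=> h h' i; rewrite !coefB; apply: (ph_sub hG). Qed.

Lemma ph_polyM p q p' q' : ph_poly p q -> ph_poly p' q' -> ph_poly (p * p') (q * q').
Proof.
by move=> h h' i; rewrite !coefM; apply: ph_sum => k; apply: (ph_mul hG).
Qed.

Lemma ph_poly_map (q : {poly E}) : ph_poly (map_poly j q) (map_poly j q).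
Proof. by move=> i; rewrite coef_map; exact: ph_base. Qed.

(** Let p be a polynomial of least size over the domain that vanishes at z, and p' the polynomial
    over the image that corresponds to it.  Any root z' of p' is a possible image of z: by
    pseudo-division by p, whatever vanishes at z is sent to something that vanishes at z'. *)
Lemma extend_one_point z : exists z' G', [/\ partial_hom G', (G `<=` G')%classic & G' (z, z')].
Proof.
pose A n := `[< exists p q, [/\ ph_poly p q, p != 0, root p z & size p = n] >].
have exA : exists n, A n.
  have [q q0 rq] := algE z; exists (size q); apply/asboolP.
  exists (map_poly j q), (map_poly j q); split=> //; first exact: ph_poly_map.
    by rewrite map_poly_eq0.
  by rewrite size_map_poly.
case: (ex_minnP exA) => n /asboolP[p [p' [hp p0 rp sp]]] minp.
have sp' : size p' = size p by rewrite (ph_poly_size hp).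
have sp1 : (1 < size p)%N.
  rewrite ltnNge; apply/negP => /size1_polyC e; move: rp p0; rewrite e.
  by rewrite rootC polyC_eq0 => ->.
have /closed_rootP[z' rz'] : size p' != 1%N by rewrite sp' gtn_eqF.
have key q q' : ph_poly q q' -> q.[z] = 0 -> q'.[z'] = 0.
  move: {2}(size q) (leqnn (size q)) => m; elim: m q q' => [|m IH] q q' sq hq qz.
    have q'0 : q' = 0 by apply/eqP; rewrite -size_poly_eq0 -(ph_poly_size hq) -leqn0.
    by rewrite q'0 horner0.
  have [q0|q0] := eqVneq q 0.
    have q'0 : q' = 0 by apply/eqP; rewrite -size_poly_eq0 -(ph_poly_size hq) q0 size_poly0.
    by rewrite q'0 horner0.
  have le : (size p <= size q)%N.
    by rewrite sp; apply: minp; apply/asboolP; exists q, q'; split=> //; apply/rootP.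
  pose k := (size q - size p)%N.
  pose r := (lead_coef p)%:P * q - (lead_coef q)%:P * 'X^k * p.
  pose r' := (lead_coef p')%:P * q' - (lead_coef q')%:P * 'X^k * p'.
  have hX : ph_poly 'X^k 'X^k.
    by elim: (k) => [|l IHl]; [exact: (ph_polyC ph1) | rewrite exprS; exact: ph_polyM ph_polyX IHl].
  have hlp : G (lead_coef p, lead_coef p') by rewrite !lead_coefE sp'; exact: hp.
  have hlq : G (lead_coef q, lead_coef q').
    by rewrite !lead_coefE -(ph_poly_size hq); exact: hq.
  have hr : ph_poly r r'.
    by apply: ph_polyB; apply: ph_polyM => //; [exact: ph_polyC | apply: ph_polyM => //; exact: ph_polyC].
  have sr : (size r <= m)%N.
    apply/leq_sizeP => i hi; rewrite coefB mulrAC coefMXn !coefCM.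
    have hqi : ((size q).-1 <= i)%N.
      by apply: leq_trans hi; rewrite -ltnS prednK // size_poly_gt0.
    move: hqi; rewrite leq_eqVlt => /orP[/eqP <-|lt].
      rewrite ltnNge -/(lead_coef q).
      have -> : (k <= (size q).-1)%N.
        by rewrite /k -subn1 leq_sub2l // ltnW.
      rewrite /= (_ : ((size q).-1 - k = (size p).-1)%N); last first.
        rewrite /k; move: le sp1; case: (size p) => // a; case: (size q) => // b.
        by rewrite ltnS subSS /= => le _; rewrite subKn.
      by rewrite -/(lead_coef p) mulrC subrr.
    have sqi : (size q <= i)%N by move: lt; case: (size q).
    rewrite (nth_default _ sqi) mulr0 sub0r.
    case: ltnP => ki; first by rewrite oppr0.
    rewrite [p`_ _]nth_default ?mulr0 ?oppr0 //.
    by rewrite leq_subRL // /k subnK.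
  have rz : r.[z] = 0 by rewrite !hornerE qz (rootP rp) !mulr0 subrr.
  have := IH _ _ sr hr rz.
  rewrite !hornerE (rootP rz') mulr0 subr0 => /eqP; rewrite mulf_eq0 lead_coef_eq0.
  by rewrite -size_poly_eq0 sp' size_poly_eq0 (negPf p0) => /eqP.
pose G' : set (K * K) :=
  [set u | exists q q', ph_poly q q' /\ u = (q.[z], q'.[z'])]%classic.
exists z', G'; split; last by exists 'X, 'X; split; [exact: ph_polyX | rewrite !hornerX].
- split.
  + move=> e; exists (j e)%:P, (j e)%:P; rewrite !hornerC; split=> //.
    by apply: ph_polyC; exact: ph_base.
  + move=> _ _ _ _ [q [q' [hq [-> ->]]]] [r [r' [hr [-> ->]]]].
    exists (q - r), (q' - r'); rewrite !hornerE; split=> //; exact: ph_polyB.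
  + move=> _ _ _ _ [q [q' [hq [-> ->]]]] [r [r' [hr [-> ->]]]].
    exists (q * r), (q' * r'); rewrite !hornerE; split=> //; exact: ph_polyM.
  + by move=> y [q [q' [hq [h ->]]]]; apply: (key q).
- by move=> [x y] Gxy; exists x%:P, y%:P; rewrite !hornerC; split=> //; exact: ph_polyC.
Qed.

End PartialHom.

(** Isomorphism extension, by Zorn's lemma: a maximal graph has domain K. *)
Theorem extend_partial_hom (G0 : set (K * K)) : partial_hom G0 ->
  exists2 s : {rmorphism K -> K}, fixes s & forall x y, G0 (x, y) -> s x = y.
Proof.
move=> hG0.
pose P : set (set (K * K)) :=
  [set G | G = set0 \/ (partial_hom G /\ (G0 `<=` G)%classic)]%classic.
have [F FP totF|G [PG maxG]] := @Zorn_bigcup _ P.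
  have [[X [FX [u Xu]]]|none] := pselect (exists X, F X /\ exists u, X u); last first.
    left; apply/seteqP; split=> // u [X FX Xu]; apply: none.
    by exists X; split=> //; exists u.
  right; have good Y u' : F Y -> Y u' -> partial_hom Y /\ (G0 `<=` Y)%classic.
    by move=> FY Yu; case: (FP _ FY) => // e; rewrite e in Yu.
  have two u1 u2 : (\bigcup_(Y in F) Y)%classic u1 -> (\bigcup_(Y in F) Y)%classic u2 ->
      exists2 Y, F Y & [/\ partial_hom Y, Y u1 & Y u2].
    move=> [Y1 F1 Yu1] [Y2 F2 Yu2]; have [le|le] := totF _ _ F1 F2.
      by exists Y2 => //; split=> //; [case: (good _ _ F2 Yu2) | exact: le].
    by exists Y1 => //; split=> //; [case: (good _ _ F1 Yu1) | exact: le].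
  split; last by move=> u0 h; exists X => //; exact: (good _ _ FX Xu).2.
  have [hX _] := good _ _ FX Xu; split.
  - by move=> e; exists X => //; exact: ph_base.
  - move=> x y x' y' h h'; have [Y FY [hY h1 h2]] := two _ _ h h'.
    by exists Y => //; exact: (ph_sub hY).
  - move=> x y x' y' h h'; have [Y FY [hY h1 h2]] := two _ _ h h'.
    by exists Y => //; exact: (ph_mul hY).
  - by move=> y [Y FY h]; have [hY _] := good _ _ FY h; exact: (ph_fun hY).
have [hG sub] : partial_hom G /\ (G0 `<=` G)%classic.
  case: PG => // G_0; exfalso; apply: (maxG G0); last by right; split.
  rewrite G_0; split; first by move=> u.
  by move=> h; apply: (h (0, 0)); exact: ph0.
have dom x : exists y, G (x, y).
  have [y [G' [hG' le G'xy]]] := extend_one_point hG x; exists y.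
  apply: contrapT => nG; apply: (maxG G').
    by split=> // le'; apply: nG; exact: le'.
  by right; split=> //; exact: subset_trans le.
pose s x := projT1 (cid (dom x)).
have sG x : G (x, s x) by rewrite /s; case: cid.
have uni x y : G (x, y) -> s x = y.
  move=> h; apply/eqP; rewrite -subr_eq0; apply/eqP; apply: (ph_fun hG).
  by rewrite -(subrr x); apply: (ph_sub hG).
have [||sg sgE] := @rmorphism_of K K s.
- by move=> x y; apply: uni; apply: (ph_sub hG).
- by split=> [|x y]; apply: uni; [exact: ph1 | apply: (ph_mul hG)].
exists sg => [e|x y h]; rewrite sgE; apply: uni; [exact: ph_base | exact: sub].
Qed.

Lemma fixes_map_poly (s : {rmorphism K -> K}) (q : {poly E}) :
  fixes s -> map_poly s (map_poly j q) = map_poly j q.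
Proof. by move=> fs; rewrite -map_poly_comp; apply: eq_map_poly => e /=. Qed.

Lemma fixes_root (s : {rmorphism K -> K}) (q : {poly E}) x :
  fixes s -> root (map_poly j q) x -> root (map_poly j q) (s x).
Proof.
by move=> fs rx; rewrite -(fixes_map_poly q fs) /root horner_map /= (rootP rx) rmorph0.
Qed.

Lemma conjugates x : exists cs : seq K,
  forall s : {rmorphism K -> K}, fixes s -> s x \in cs.
Proof.
have [q q0 rq] := algE x.
have [rs ers] := closed_field_poly_normal (map_poly j q).
exists rs => s fs; have := fixes_root fs rq; rewrite ers rootZ ?root_prod_XsubC //.
by rewrite lead_coef_eq0 map_poly_eq0.
Qed.

(** An endomorphism over E permutes the finite root set of each polynomial over E. *)
Lemma inverse_aut (s : {rmorphism K -> K}) : fixes s ->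
  exists2 t : {rmorphism K -> K}, fixes t & cancel s t /\ cancel t s.
Proof.
move=> fs; have surj y : exists x, s x = y.
  have [q q0 rq] := algE y.
  have [rs0 ers] := closed_field_poly_normal (map_poly j q).
  pose rs := undup rs0.
  have mrs x : (x \in rs) = root (map_poly j q) x.
    by rewrite mem_undup ers rootZ ?root_prod_XsubC // lead_coef_eq0 map_poly_eq0.
  have us : uniq (map s rs) by rewrite map_inj_uniq ?undup_uniq //; exact: fmorph_inj.
  have sub : {subset map s rs <= rs}.
    by move=> _ /mapP[x xr ->]; rewrite mrs; apply: fixes_root => //; rewrite -mrs.
  have [|_ e] := uniq_min_size us sub; first by rewrite size_map.
  have : y \in map s rs by rewrite e mrs.
  by case/mapP => x _ ->; exists x.
pose t y := projT1 (cid (surj y)).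
have st : cancel t s by move=> y; rewrite /t; case: cid.
have ts : cancel s t by move=> x; apply: (fmorph_inj s); rewrite st.
have [||tg tE] := @rmorphism_of K K t.
- by move=> x y; apply: (fmorph_inj s); rewrite rmorphB !st.
- by split=> [|x y]; apply: (fmorph_inj s); rewrite ?rmorph1 ?rmorphM !st.
exists tg; first by move=> e; rewrite tE -{1}(fs e) ts.
by split=> x; rewrite tE.
Qed.

(** Compactness of Aut(K/E).  The pairs (x, y) such that finitely many of the prescribed values
    already force x to be sent to y form the graph of a partial homomorphism. *)
Theorem automorphism_compactness (X : set K) (m : K -> K) :
  (forall F : seq K, (forall x, x \in F -> X x) ->
     exists2 s : {rmorphism K -> K}, fixes s & {in F, s =1 m}) ->
  exists2 s : {rmorphism K -> K}, fixes s & forall x, X x -> s x = m x.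
Proof.
move=> hF.
pose G0 : set (K * K) := [set u | exists2 F : seq K, (forall x, x \in F -> X x) &
  forall s : {rmorphism K -> K}, fixes s -> {in F, s =1 m} -> s u.1 = u.2]%classic.
have [|s fs sG] := @extend_partial_hom G0; last first.
  exists s => // x Xx; apply: sG; exists [:: x] => [y|s' fs' h]; first by rewrite inE => /eqP ->.
  by apply: h; rewrite inE.
have two (u1 u2 u3 : K * K) :
    (forall s : {rmorphism K -> K}, s u1.1 = u1.2 -> s u2.1 = u2.2 -> s u3.1 = u3.2) ->
    G0 u1 -> G0 u2 -> G0 u3.
  move=> h [F1 XF1 h1] [F2 XF2 h2]; exists (F1 ++ F2).
    by move=> x; rewrite mem_cat => /orP[/XF1|/XF2].
  move=> s fs hs; apply: h; [apply: h1 | apply: h2] => // x xF; apply: hs;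
    by rewrite mem_cat xF ?orbT.
split.
- by move=> e; exists [::] => // s fs _; exact: fs.
- move=> x y x' y'; apply: two => s /= <- <-.
  by rewrite rmorphB.
- move=> x y x' y'; apply: two => s /= <- <-.
  by rewrite rmorphM.
- move=> y [F XF h]; have [s fs hs] := hF F XF.
  by have := h s fs hs; rewrite /= rmorph0.
Qed.

(** The point w has finitely many conjugates c; for each c that is not the image of w under an
    automorphism fixing X, compactness supplies a finite part of X that already excludes c. *)
Lemma correct_on_point (X : set K) w : exists2 xs : seq K, (forall x, x \in xs -> X x) &
  forall s : {rmorphism K -> K}, fixes s -> {in xs, s =1 id} ->
  exists2 r : {rmorphism K -> K}, fixes r & r w = s w /\ forall x, X x -> r x = x.
Proof.
have [Xw|nXw] := pselect (X w).
  exists [:: w] => [x|s fs h]; first by rewrite inE => /eqP ->.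
  by exists idfun => //; rewrite h ?inE.
have [cs hcs] := conjugates w.
suff [xs Xxs h] : exists2 xs : seq K, (forall x, x \in xs -> X x) &
    forall s : {rmorphism K -> K}, fixes s -> {in xs, s =1 id} -> s w \in cs ->
    exists2 r : {rmorphism K -> K}, fixes r & r w = s w /\ forall x, X x -> r x = x.
  by exists xs => // s fs hs; apply: h => //; exact: hcs.
elim: cs {hcs} => [|c cs [xs Xxs h]]; first by exists [::].
have [[r fr [rw rX]]|none] := pselect (exists2 r : {rmorphism K -> K}, fixes r &
    r w = c /\ forall x, X x -> r x = x).
  exists xs => // s fs hs; rewrite inE => /orP[/eqP e|]; last exact: h.
  by exists r => //; rewrite e.
have [F FX hF] : exists2 F : seq K, (forall x, x \in F -> x = w \/ X x) &
    forall s : {rmorphism K -> K}, fixes s ->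
      ~ {in F, forall x, s x = if x == w then c else x}.
  apply: contrapT => nF; apply: none.
  have [|r fr hr] := @automorphism_compactness [set x | x = w \/ X x]%classic
      (fun x => if x == w then c else x).
    move=> F FX; apply: contrapT => ns; apply: nF; exists F => // s fs hs.
    by apply: ns; exists s.
  exists r => //; split; first by rewrite hr ?eqxx; [|left].
  move=> x Xx; rewrite hr; last by right.
  by case: eqP => // e; rewrite e in Xx.
exists (xs ++ [seq x <- F | x != w]).
  move=> x; rewrite mem_cat => /orP[/Xxs //|]; rewrite mem_filter => /andP[xw /FX[e|//]].
  by rewrite e eqxx in xw.
move=> s fs hs; rewrite inE => /orP[/eqP e|]; last first.
  by apply: h => // x xxs; apply: hs; rewrite mem_cat xxs.
exfalso; apply: (hF s fs) => x xF; case: eqP => [->//|/eqP xw].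
by apply: hs; rewrite mem_cat mem_filter xw xF orbT.
Qed.

(** Openness: an automorphism that fixes a suitable finite part of X agrees on W with one that
    fixes all of X, so its restriction to X extends to an automorphism that fixes W. *)
Lemma correct_on_seq (X : set K) (W : seq K) :
  exists2 xs : seq K, (forall x, x \in xs -> X x) &
  forall s : {rmorphism K -> K}, fixes s -> {in xs, s =1 id} ->
  exists2 r : {rmorphism K -> K}, fixes r & {in W, r =1 s} /\ forall x, X x -> r x = x.
Proof.
elim: W X => [|w W IH] X; first by exists [::] => // s fs _; exists idfun.
have [xs1 X1 h1] := correct_on_point X w.
have [xs2 X2 h2] := IH [set x | x = w \/ X x]%classic.
exists (xs1 ++ [seq x <- xs2 | `[< X x >]]).
  by move=> x; rewrite mem_cat => /orP[/X1 //|]; rewrite mem_filter => /andP[/asboolP].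
move=> s fs hs.
have [|r1 fr1 [r1w r1X]] := h1 s fs.
  by move=> x x1; apply: hs; rewrite mem_cat x1.
have [t1 ft1 [rt tr]] := inverse_aut fr1.
have fts : fixes (t1 \o s) by move=> e /=; rewrite fs ft1.
have [|r2 fr2 [r2W r2X]] := h2 _ fts.
  move=> x x2 /=; have [Xx|nXx] := pselect (X x).
    have -> : s x = x by apply: hs; rewrite mem_cat mem_filter x2 andbT (asboolT Xx) orbT.
    by rewrite -{1}(r1X x Xx) rt.
  by case: (X2 x x2) => // ->; rewrite -r1w rt.
exists (r1 \o r2); first by move=> e /=; rewrite fr2 fr1.
split=> x /=; last by move=> Xx; rewrite r2X; [exact: r1X | right].
rewrite inE => /orP[/eqP ->|xW]; first by rewrite r2X; [|left].
by rewrite r2W //= tr.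
Qed.

End Automorphisms.

(** * Virtually abelian Galois groups and commuting automorphisms *)

Section Criterion.
Variables (E : fieldType) (K : closedFieldType) (j : {rmorphism E -> K}).
Hypothesis algE : forall x : K, exists2 q : {poly E}, q != 0 & root (map_poly j q) x.

(** The set W stands for a finite extension of E, which may lie outside of E(S). *)
Definition virtually_commuting (S : set K) : Prop := exists W : seq K,
  forall s t : {rmorphism K -> K}, fixes j s -> fixes j t ->
  {in W, s =1 id} -> {in W, t =1 id} -> forall x, S x -> s (t x) = t (s x).

Definition aut_stable (S : set K) : Prop :=
  forall s : {rmorphism K -> K}, fixes j s -> forall x, S x -> S (s x).

Variable S : set K.
Hypothesis stS : aut_stable S.
Let L := adjoin j S.
Let GalS := @galois_group E K j S.

Lemma adjoin_base e : j e \in adjoin_pred j S.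
Proof. by apply/asboolP => M _ h _; exact: h. Qed.

Lemma adjoin_gen x : S x -> x \in adjoin_pred j S.
Proof. by move=> Sx; apply/asboolP => M _ _ h; exact: h. Qed.

Lemma adjoin_ind (M : {pred K}) : divring_closed M -> (forall e, j e \in M) ->
  (forall x, S x -> x \in M) -> forall x, x \in adjoin_pred j S -> x \in M.
Proof. by move=> h1 h2 h3 x /asboolP; apply. Qed.

Lemma adjoin_stable (s : {rmorphism K -> K}) : fixes j s ->
  forall x, x \in adjoin_pred j S -> s x \in adjoin_pred j S.
Proof.
move=> fs; pose M : {pred K} := fun x => s x \in adjoin_pred j S.
have ME y : (y \in M) = (s y \in adjoin_pred j S) by [].
suff : forall x, x \in adjoin_pred j S -> x \in M by [].
apply: adjoin_ind.
- split=> [|x y|x y]; rewrite !ME.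
  + by rewrite rmorph1; exact: rpred1.
  + by rewrite rmorphB; exact: rpredB.
  + by rewrite fmorph_div; exact: rpred_div.
- by move=> e; rewrite ME fs; exact: adjoin_base.
- by move=> x Sx; rewrite ME; apply: adjoin_gen; exact: stS.
Qed.

Definition restrict (s : {rmorphism K -> K}) (fs : fixes j s) (x : L) : L :=
  Adjoin (adjoin_stable fs (valP x)).

Lemma restrict_galois (s : {rmorphism K -> K}) (fs : fixes j s) : GalS (restrict fs).
Proof.
have [t ft [st ts]] := inverse_aut algE fs.
split.
- by move=> x y; apply: val_inj; rewrite /= !rmorphB.
- by split=> [|x y]; apply: val_inj; rewrite /= ?rmorph1 ?rmorphM.
- by exists (restrict ft) => x; apply: val_inj; rewrite /= ?st ?ts.
- by move=> x e xe; apply: val_inj => /=; rewrite xe fs.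
Qed.

Lemma galois_extend t : GalS t ->
  exists2 s : {rmorphism K -> K}, fixes j s & forall x : L, s (val x) = val (t x).
Proof.
move=> [tB [t1 tM] _ tE].
have [|s fs h] := @extend_partial_hom E K j algE
   [set u | exists x : L, u = (val x, val (t x))]%classic.
  split.
  - move=> e; exists (Adjoin (adjoin_base e)).
    by rewrite (tE _ e).
  - by move=> _ _ _ _ [x [-> ->]] [y [-> ->]]; exists (x - y); rewrite tB !rmorphB.
  - by move=> _ _ _ _ [x [-> ->]] [y [-> ->]]; exists (x * y); rewrite tM !rmorphM.
  - move=> _ [x [x0 ->]]; have -> : x = x - x by apply: val_inj; rewrite subrr rmorph0; exact/esym/x0.
    by rewrite tB subrr.
by exists s => // x; apply: h; exists x.
Qed.

(** For an open abelian subgroup H, a finite set that defines a neighbourhood of the identity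
    inside H serves as W.  Given W, the restrictions of automorphisms that fix W form a
    commutative subgroup, which is open by [correct_on_seq]. *)
Lemma virtually_abelianP : virtually_abelian GalS <-> virtually_commuting S.
Proof.
split.
  move=> [H [[HG H1 HM HV] Hopen Hab]].
  have [xs hxs] := Hopen _ H1.
  exists [seq val x | x <- xs] => s t fs ft hs ht x Sx.
  have inH (r : {rmorphism K -> K}) (fr : fixes j r) : {in [seq val x | x <- xs], r =1 id} -> H (restrict fr).
    move=> hr; apply: hxs; first exact: restrict_galois.
    by move=> y yxs; apply: val_inj => /=; apply: hr; apply: map_f.
  have := Hab _ _ (inH _ fs hs) (inH _ ft ht) (Adjoin (adjoin_gen Sx)).
  by move/(congr1 val).
move=> [W hW].
pose H : set (L -> L) := [set t | GalS t /\ exists s : {rmorphism K -> K},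
  [/\ fixes j s, {in W, s =1 id} & forall x : L, s (val x) = val (t x)]]%classic.
exists H; split.
- split.
  + by move=> t [].
  + split; last by exists idfun.
    by split=> //; exists idfun.
  + move=> t1 t2 [[t1B [t11 t1M] b1 t1E] [s1 [f1 h1 e1]]] [[t2B [t21 t2M] b2 t2E] [s2 [f2 h2 e2]]].
    split; last first.
      exists (s1 \o s2); split=> [e|w wW|x] /=; rewrite ?f2 ?f1 ?e2 ?e1 //.
      by rewrite (h2 w wW) (h1 w wW).
    split.
    * by move=> x y /=; rewrite t2B t1B.
    * by split=> [|x y] /=; rewrite ?t21 ?t11 ?t2M ?t1M.
    * exact: bij_comp.
    * by move=> x e xe /=; rewrite (t2E x e xe) (t1E x e xe).
  + move=> t1 [[t1B [t11 t1M] [t2 k1 k2] t1E] [s1 [f1 h1 e1]]].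
    have [s2 f2 [c1 c2]] := inverse_aut algE f1.
    exists t2; split=> //; split; last first.
      exists s2; split=> // [w wW|x]; first by rewrite -{1}(h1 w wW) c1.
      by rewrite -{1}(k2 x) -e1 c1.
    have inj1 := can_inj k1.
    split.
    * by move=> x y; apply: inj1; rewrite t1B !k2.
    * by split=> [|x y]; apply: inj1; rewrite ?t11 ?t1M !k2.
    * by exists t1.
    * by move=> x e xe; apply: inj1; rewrite k2 (t1E x e xe).
- move=> t0 [_ [s0 [f0 h0 e0]]].
  have [xs Lxs hxs] := correct_on_seq algE [set x | x \in adjoin_pred j S]%classic W.
  exists (pmap insub xs) => t Gt tt0; split=> //.
  (* s0^-1 s fixes xs, so r^-1 s0^-1 s fixes W and restricts to t0^-1 t; multiply by s0. *)
  have [s fs es] := galois_extend Gt.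
  have [s0' f0' [c1 c2]] := inverse_aut algE f0.
  have fsig : fixes j (s0' \o s) by move=> e /=; rewrite fs f0'.
  have [|r fr [rW rL]] := hxs _ fsig.
    move=> x xxs /=; have Lx : x \in adjoin_pred j S by exact: Lxs.
    pose x' : L := Adjoin Lx.
    have -> : s x = s0 x by rewrite -[x]/(val x') es e0 tt0 // mem_pmap_sub.
    by rewrite c1.
  have [r' fr' [d1 d2]] := inverse_aut algE fr.
  exists (s0 \o r' \o s0' \o s); split.
  + by move=> e /=; rewrite fs f0' fr' f0.
  + by move=> w wW /=; rewrite -[s0' (s w)]/((s0' \o s) w) -rW // d1 h0.
  + move=> x /=; rewrite es; set y := s0' _.
    have yL : y \in adjoin_pred j S by apply: (adjoin_stable f0'); exact: valP.
    by rewrite -{1}(rL y yL) d1 /y c2.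
- move=> t1 t2 [_ [s1 [f1 h1 e1]]] [_ [s2 [f2 h2 e2]]] x.
  apply: val_inj; rewrite /= -e1 -e2 -e2 -e1.
  pose M : {pred K} := fun y => s1 (s2 y) == s2 (s1 y).
  suff : forall y, y \in adjoin_pred j S -> y \in M.
    by move=> /(_ _ (valP x)) /eqP.
  have ME y : (y \in M) = (s1 (s2 y) == s2 (s1 y)) by [].
  apply: adjoin_ind.
  + split=> [|y z|y z]; rewrite !ME; first by rewrite !rmorph1.
      by move=> /eqP h /eqP h'; rewrite !rmorphB h h'.
    by move=> /eqP h /eqP h'; rewrite !fmorph_div h h'.
  + by move=> e; rewrite ME f2 !f1 f2.
  + by move=> y Sy; rewrite ME; apply/eqP; apply: hW.
Qed.

End Criterion.

(** * Taylor expansion and additive polynomials *)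

Lemma comp_sub_factor (R : comNzRingType) (p x y : {poly R}) :
  exists s, (p \Po x) - (p \Po y) = (x - y) * s.
Proof.
have rt : root (p^:P - (p \Po y)%:P) y.
  by rewrite /root !hornerE subrr.
have [q e] := factor_theorem _ _ rt.
exists q.[x]; have /(congr1 (fun r => r.[x])) := e.
by rewrite !hornerE [RHS]mulrC => <-.
Qed.

Lemma coef_comp_XaddC (R : comNzRingType) (p : {poly R}) (c : R) n :
  (p \Po ('X + c%:P))`_n = p^`N(n).[c].
Proof.
have cxc : GRing.comm c%:P 'X by exact: mulrC.
rewrite addrC /comp_poly (nderiv_taylor p^:P cxc).
rewrite coef_sum size_map_polyC.
have e i : p^:P^`N(i).[c%:P] * 'X^i = p^`N(i).[c] *: 'X^i.
  by rewrite -mul_polyC nderivn_map horner_map.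
under eq_bigr do rewrite e coefZ coefXn.
have [lt|ge] := ltnP n (size p).
  rewrite (bigD1 (Ordinal lt)) //= eqxx mulr1 big1 ?addr0 // => i.
  by rewrite -val_eqE /= eq_sym => /negPf ->; rewrite mulr0.
rewrite big1 => [|i _]; last first.
  by rewrite gtn_eqF ?mulr0 // (leq_trans (ltn_ord i)).
suff -> : p^`N(n) = 0 by rewrite horner0.
by apply/polyP => i; rewrite coef_nderivn coef0 nth_default ?mul0rn // (leq_trans ge) ?leq_addr.
Qed.

(** The polynomial f(u + eps), in the outer variable eps with coefficients in the variable
    of u. *)
Definition taylor (K : comNzRingType) (f u : {poly K}) : {poly {poly K}} :=
  f^:P \Po ('X + u%:P).

Lemma coef_taylor (K : comNzRingType) (f u : {poly K}) n :
  (taylor f u)`_n = f^`N(n) \Po u.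
Proof. by rewrite /taylor coef_comp_XaddC nderivn_map. Qed.

Definition additive_poly (K : nzRingType) (L : {poly K}) :=
  forall x y, L.[x + y] = L.[x] + L.[y].

Section AdditivePoly.
Variable K : closedFieldType.
Implicit Types (L : {poly K}) (p q : {poly K}).

Lemma poly_ext p q : (forall x, p.[x] = q.[x]) -> p = q.
Proof.
move=> h; apply/eqP; rewrite -subr_eq0; apply/negPn/negP => /closed_nonrootP[x].
by rewrite /root !hornerE h subrr eqxx.
Qed.

Lemma poly_onto p y : (1 < size p)%N -> exists x, p.[x] = y.
Proof.
move=> sp; have : size (p - y%:P) != 1%N.
  rewrite size_polyDl ?size_polyN ?(leq_ltn_trans (size_polyC_leq1 _)) //.
  by rewrite gtn_eqF.
by move/closed_rootP => [x]; rewrite /root !hornerE subr_eq0 => /eqP; exists x.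
Qed.

Lemma additive_poly0 L : additive_poly L -> L.[0] = 0.
Proof.
by move=> aL; have /eqP := aL 0 0; rewrite addr0 -subr_eq0 opprD addNKr oppr_eq0 => /eqP.
Qed.

Lemma additive_polyN L x : additive_poly L -> L.[- x] = - L.[x].
Proof.
move=> aL; apply/eqP; rewrite -addr_eq0 -aL addNr; apply/eqP.
exact: additive_poly0.
Qed.

Lemma additive_polyB L x y : additive_poly L -> L.[x - y] = L.[x] - L.[y].
Proof. by move=> aL; rewrite aL additive_polyN. Qed.

(** Expand L(x + eps) = L(x) + L(eps) in powers of eps. *)
Lemma additive_nderivn L n : additive_poly L -> (0 < n)%N ->
  L^`N(n) = (L`_n)%:P.
Proof.
move=> aL n0; apply: poly_ext => x; rewrite hornerC -coef_comp_XaddC.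
have -> : L \Po ('X + x%:P) = L + L.[x]%:P.
  by apply: poly_ext => y; rewrite horner_comp !hornerE aL.
by rewrite coefD coefC gtn_eqF // addr0.
Qed.

Lemma taylor_additive L u : additive_poly L -> taylor L u = (L \Po u)%:P + L^:P.
Proof.
move=> aL; apply/polyP => n; rewrite coef_taylor coefD coefC coef_map /=.
have [->|n0] := posnP n; first by rewrite -horner_coef0 (additive_poly0 aL) addr0 nderivn0.
by rewrite additive_nderivn // comp_polyC add0r.
Qed.

End AdditivePoly.

(** * Newton polygons of products *)

(** For P in K[x][eps] the weight of the term c(x) eps^i is its order of growth as x tends to
    infinity and eps decays like x^(-b/a), multiplied by a. *)
Section NewtonPolygon.
Variables (K : idomainType) (a b : nat).
Hypothesis a_gt0 : (0 < a)%N.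
Implicit Types (P R S : {poly {poly K}}) (c : {poly K}).

Definition weight c i : int := (a * (size c).-1)%:Z - (b * i)%:Z.

Lemma weight_add (n : nat) (w : int) c d :
  (c != 0 -> weight c n < w) -> (d != 0 -> weight d n < w) ->
  c + d != 0 -> weight (c + d) n < w.
Proof.
have [-> _|c0 /(_ isT) wc] := eqVneq c 0; first by rewrite add0r.
have [-> _|d0 /(_ isT) wd _] := eqVneq d 0; first by rewrite addr0.
have := size_polyD c d; rewrite leq_max => /orP[] h.
  apply: le_lt_trans wc; rewrite /weight lerD2r lez_nat leq_mul2l.
  by rewrite -!subn1 leq_sub2r ?orbT.
apply: le_lt_trans wd; rewrite /weight lerD2r lez_nat leq_mul2l.
by rewrite -!subn1 leq_sub2r ?orbT.
Qed.

Lemma weight_sum (n : nat) (w : int) (I : finType) (Q : pred I) (F : I -> {poly K}) :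
  (forall k, Q k -> F k != 0 -> weight (F k) n < w) ->
  \sum_(k | Q k) F k != 0 -> weight (\sum_(k | Q k) F k) n < w.
Proof.
move=> h; elim/big_rec: _ => [|i c Qi IH]; first by rewrite eqxx.
by apply: weight_add => //; apply: h.
Qed.

Lemma weight_mul c d i k :
  c != 0 -> d != 0 -> weight (c * d) (i + k) = weight c i + weight d k.
Proof.
move=> c0 d0; rewrite /weight size_mul //.
have := size_poly_gt0 c; have := size_poly_gt0 d; rewrite c0 d0 => h1 h2.
have -> : (size c + size d).-1.-1 = ((size c).-1 + (size d).-1)%N by lia.
by rewrite !mulnDr !PoszD; lia.
Qed.

Lemma coef_mul_weight_le R S (w w' : int) n :
  (forall i, R`_i != 0 -> weight R`_i i <= w) ->
  (forall i, S`_i != 0 -> weight S`_i i <= w') ->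
  (R * S)`_n != 0 -> weight (R * S)`_n n <= w + w'.
Proof.
move=> hR hS; rewrite coefM => h; rewrite -ltzD1 addrC.
apply: weight_sum h => k _; rewrite mulf_eq0 negb_or => /andP[h1 h2].
have := weight_mul k (n - k) h1 h2; rewrite subnKC -1?ltnS // => ->.
by have := hR _ h1; have := hS _ h2; lia.
Qed.

(** A term of strictly larger weight cannot be cancelled. *)
Lemma weight_dominant m s n :
  m != 0 -> (s != 0 -> weight s n < weight m n) ->
  m + s != 0 /\ weight (m + s) n = weight m n.
Proof.
move=> m0 ws; have sz : size (m + s) = size m.
  have [->|s0] := eqVneq s 0; first by rewrite addr0.
  apply: size_polyDl; have := ws s0; rewrite /weight ltrD2r ltz_nat.
  rewrite ltn_mul2l a_gt0 /=.
  by have := size_poly_gt0 m; rewrite m0; lia.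
by rewrite -size_poly_eq0 sz size_poly_eq0 m0 /weight sz.
Qed.

Lemma coef_mul_weight_eq R S i j :
  R`_i != 0 -> S`_j != 0 ->
  (forall k l, (k + l = i + j)%N -> k != i -> R`_k != 0 -> S`_l != 0 ->
     weight R`_k k + weight S`_l l < weight R`_i i + weight S`_j j) ->
  (R * S)`_(i + j) != 0 /\
  weight (R * S)`_(i + j) (i + j) = weight R`_i i + weight S`_j j.
Proof.
move=> Ri Sj h; have ij : (i < (i + j).+1)%N by lia.
rewrite coefM (bigD1 (Ordinal ij)) //= addKn.
set m := R`_i * S`_j; set s := \sum_(_ < _ | _) _.
have m0 : m != 0 by rewrite mulf_neq0.
have wm : weight m (i + j) = weight R`_i i + weight S`_j j.
  by rewrite weight_mul.
have ws : s != 0 -> weight s (i + j) < weight m (i + j).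
  apply: weight_sum => k; rewrite -val_eqE /= => ki.
  rewrite mulf_eq0 negb_or => /andP[h1 h2].
  have e : (k + (i + j - k) = i + j)%N by have := ltn_ord k; lia.
  by have := weight_mul k (i + j - k) h1 h2; rewrite e wm => ->; apply: h.
by rewrite -wm; apply: weight_dominant.
Qed.

Lemma max_weight P : P != 0 ->
  exists2 w : int, (forall i, P`_i != 0 -> weight P`_i i <= w)
   & exists2 i, P`_i != 0 & weight P`_i i = w.
Proof.
move=> P0; have sP : ((size P).-1 < size P)%N by rewrite prednK ?size_poly_gt0.
have hl : P`_(Ordinal sP) != 0 by rewrite -/(lead_coef P) lead_coef_eq0.
pose nz : pred 'I_(size P) := fun i => P`_i != 0.
have [i Pi hi] := @arg_maxP _ int _ (Ordinal sP) nz (fun i => weight P`_i i) hl.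
exists (weight P`_i i); last by exists i.
move=> k Pk; have kP : (k < size P)%N.
  by rewrite ltnNge; apply: contraNN Pk => /(nth_default 0) ->.
exact: (hi (Ordinal kP)).
Qed.

Lemma min_edge P (w : int) : (exists2 i, P`_i != 0 & weight P`_i i = w) ->
  exists i, [/\ P`_i != 0, weight P`_i i = w &
    forall k, (k < i)%N -> P`_k != 0 -> weight P`_k k <> w].
Proof.
move=> [i Pi wi]; have ex : exists i, (P`_i != 0) && (weight P`_i i == w).
  by exists i; rewrite Pi wi eqxx.
case: (ex_minnP ex) => m /andP[Pm /eqP wm] hm; exists m; split=> // k km Pk wk.
by have := hm k; rewrite Pk wk eqxx leqNgt km => /(_ isT).
Qed.

Lemma max_edge P (w : int) : (exists2 i, P`_i != 0 & weight P`_i i = w) ->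
  exists i, [/\ P`_i != 0, weight P`_i i = w &
    forall k, (i < k)%N -> P`_k != 0 -> weight P`_k k <> w].
Proof.
move=> [i Pi wi]; have ex : exists i, (P`_i != 0) && (weight P`_i i == w).
  by exists i; rewrite Pi wi eqxx.
have ub k : (P`_k != 0) && (weight P`_k k == w) -> (k <= size P)%N.
  move=> /andP[Pk _]; apply: ltnW.
  by rewrite ltnNge; apply: contraNN Pk => /(nth_default 0) ->.
case: (ex_maxnP ex ub) => m /andP[Pm /eqP wm] hm; exists m; split=> // k km Pk wk.
by have := hm k; rewrite Pk wk eqxx leqNgt km => /(_ isT).
Qed.

Let lt_leD (x y w w' : int) : x <= w -> x <> w -> y <= w' -> x + y < w + w'.
Proof. by move=> h1 /eqP h2 h3; apply: ltr_leD => //; rewrite lt_neqAle h2. Qed.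

Let le_ltD (x y w w' : int) : x <= w -> y <= w' -> y <> w' -> x + y < w + w'.
Proof. by move=> h1 h2 h3; rewrite addrC (addrC w); apply: lt_leD. Qed.

(** Multiplicativity of leading forms, for the weighting (a, b): the lowest and the highest term
    of the leading form of R S are the products of those of R and of S.  Hence, if the leading
    form of R has two terms, so has that of R S. *)
Lemma edge_not_factor R S i1 i2 i0 :
  R`_i1 != 0 -> R`_i2 != 0 -> i1 != i2 -> weight R`_i1 i1 = weight R`_i2 i2 ->
  (forall i, R`_i != 0 -> weight R`_i i <= weight R`_i1 i1) ->
  (R * S)`_i0 != 0 ->
  (forall i, i != i0 -> (R * S)`_i != 0 ->
     weight (R * S)`_i i < weight (R * S)`_i0 i0) ->
  False.
Proof.
wlog lt12 : i1 i2 / (i1 < i2)%N => [hw|].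
  move=> h1 h2 n12 e12 hR; have [lt|lt|e] := ltngtP i1 i2.
  - exact: (hw i1 i2).
  - by apply: (hw i2 i1) => //; rewrite 1?eq_sym // -e12.
  - by rewrite e eqxx in n12.
move=> R1 R2 _ e12 hR B0 hB.
have S0 : S != 0 by apply: contraNneq B0 => ->; rewrite mulr0 coef0.
have [w' hS exS] := max_weight S0.
set w := weight R`_i1 i1 in hR.
have exR : exists2 i, R`_i != 0 & weight R`_i i = w by exists i1.
have [k1 [Rk1 wk1 hk1]] := min_edge exR.
have [k2 [Rk2 wk2 hk2]] := max_edge exR.
have [l1 [Sl1 wl1 hl1]] := min_edge exS.
have [l2 [Sl2 wl2 hl2]] := max_edge exS.
have k1i : (k1 <= i1)%N by rewrite leqNgt; apply/negP => /hk1 /(_ R1); apply.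
have k2i : (i2 <= k2)%N.
  by rewrite leqNgt; apply/negP => /hk2 /(_ R2); apply; rewrite -e12.
have l12 : (l1 <= l2)%N by rewrite leqNgt; apply/negP => /hl1 /(_ Sl2); apply.
have [|B1 wB1] := @coef_mul_weight_eq R S k1 l1 Rk1 Sl1.
  move=> k l kl nk Rk Sl; rewrite wk1 wl1.
  case: (ltnP k k1) => c.
    by apply: lt_leD (hR _ Rk) (hk1 k c Rk) (hS _ Sl).
  have c' : (l < l1)%N by move: kl nk c; clear; lia.
  by apply: le_ltD (hR _ Rk) (hS _ Sl) (hl1 l c' Sl).
have [|B2 wB2] := @coef_mul_weight_eq R S k2 l2 Rk2 Sl2.
  move=> k l kl nk Rk Sl; rewrite wk2 wl2.
  case: (ltnP k2 k) => c.
    by apply: lt_leD (hR _ Rk) (hk2 k c Rk) (hS _ Sl).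
  have c' : (l2 < l)%N by move: kl nk c; clear; lia.
  by apply: le_ltD (hR _ Rk) (hS _ Sl) (hl2 l c' Sl).
have wB0 := coef_mul_weight_le hR hS B0.
have [e1|n1] := eqVneq (k1 + l1)%N i0.
  have n2 : (k2 + l2)%N != i0.
    by move: e1 lt12 k1i k2i l12; clear; lia.
  by have := hB _ n2 B2; rewrite -e1 wB1 wB2 wk1 wk2 wl1 wl2 ltxx.
by have := hB _ n1 B1; rewrite wB1 wk1 wl1 ltNge wB0.
Qed.

End NewtonPolygon.

(** * The Newton polygon of a semiconjugacy *)

Lemma taylorD (K : comNzRingType) (f h u : {poly K}) :
  taylor (f + h) u = taylor f u + taylor h u.
Proof. by rewrite /taylor rmorphD /= comp_polyD. Qed.

Lemma taylorC (K : comNzRingType) (c : K) (u : {poly K}) : taylor c%:P u = c%:P%:P.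
Proof. by rewrite /taylor map_polyC /= comp_polyC. Qed.

(** As g(u + eps) = g(u) + L(eps), the increment f(u + eps) - f divides
    psi(f(u + eps)) - psi(f) = f(g(u) + L(eps)) - f(g). *)
Section Semiconj.
Variables (K : closedFieldType) (L : {poly K}) (Q : nat) (delta : K).
Variables (f psi : {poly K}).
Hypotheses (addL : additive_poly L) (L1 : L`_1 != 0) (sL : size L = Q.+1).
Hypothesis (Q_gt1 : (1 < Q)%N).
Let g := L + delta%:P.
Hypothesis semi : f \Po g = psi \Po f.

Lemma size_g : size g = Q.+1.
Proof.
rewrite size_polyDl sL // (leq_ltn_trans (size_polyC_leq1 _)) //.
by rewrite ltnS ltnW.
Qed.

Let increment (u : {poly K}) : {poly {poly K}} := taylor f u - f%:P.
Let image_increment (u : {poly K}) : {poly {poly K}} :=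
  (taylor f (g \Po u) \Po L^:P) - (f \Po g)%:P.

Lemma increment_dvd_image u : exists S, image_increment u = increment u * S.
Proof.
have [S eS] := comp_sub_factor psi^:P (taylor f u) f%:P.
exists S; rewrite /increment -eS comp_polyCr -/(_ \Po _) /image_increment.
congr (_ - _); last by rewrite semi.
rewrite /taylor !comp_polyA -map_comp_poly -semi map_comp_poly -!comp_polyA.
congr (_ \Po _); rewrite comp_polyD comp_polyX comp_polyC.
rewrite -/(taylor g u) {1}/g taylorD taylor_additive // taylorC.
by rewrite /g comp_polyD comp_polyC rmorphD /= addrAC addrC addrA.
Qed.

Lemma coef_additive_expr i n :
  (L ^+ i)`_n = if (n < i)%N then 0 else (L ^+ i)`_n.
Proof.
case: ifP => // lt; have /factor_theorem[L' ->] : root L 0.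
  by rewrite /root additive_poly0.
by rewrite subr0 exprMn coefMXn lt.
Qed.

Lemma coef_additive_expr_diag i : (L ^+ i)`_i = L`_1 ^+ i.
Proof.
have /factor_theorem[L' ->] : root L 0 by rewrite /root additive_poly0.
by rewrite subr0 exprMn coefMXn ltnn subnn coefMX /= -!horner_coef0 horner_exp.
Qed.

Lemma coef_image_increment0 u :
  (image_increment u)`_0 = ((f \Po g) \Po u) - (f \Po g).
Proof.
rewrite /image_increment coefB coefC /= -horner_coef0 horner_comp.
have -> : L^:P.[0] = 0 by rewrite -(rmorph0 polyC) horner_map /= additive_poly0.
by rewrite horner_coef0 coef_taylor nderivn0 comp_polyA.
Qed.

Lemma coef_image_increment u n : (0 < n)%N ->
  (image_increment u)`_n = \sum_(i < n.+1) (f^`N(i) \Po (g \Po u)) * ((L ^+ i)`_n)%:P.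
Proof.
move=> n0; rewrite /image_increment coefB coefC gtn_eqF // subr0 coef_comp_poly.
set T := taylor _ _; set m := maxn (size T) n.+1.
have eT i : T`_i * (L^:P ^+ i)`_n = (f^`N(i) \Po (g \Po u)) * ((L ^+ i)`_n)%:P.
  by rewrite coef_taylor -rmorphXn /= coef_map.
transitivity (\sum_(i < m) T`_i * (L^:P ^+ i)`_n).
  rewrite (big_ord_widen m (fun i => T`_i * (L^:P ^+ i)`_n)) ?leq_maxl //.
  rewrite big_mkcond; apply: eq_bigr => i _; case: ltnP => // h.
  by rewrite nth_default ?mul0r.
rewrite (big_ord_widen m (fun i => (f^`N(i) \Po (g \Po u)) * ((L ^+ i)`_n)%:P)) ?leq_maxr //.
rewrite [RHS]big_mkcond; apply: eq_bigr => i _; rewrite eT ltnS.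
by case: leqP => // h; rewrite coef_additive_expr h mulr0.
Qed.

(** The hypotheses describe the Newton polygon of f(u + eps) - f: its highest point is (k, M),
    and b / a is the least slope of its lower indices i < k as seen from that point, attained
    by [ex].  D0 is the constant term.  By [eC], the constant term C of f(g(u) + L(eps)) - f(g)
    vanishes, or has weight at least that of every other term, or has smaller weight than the
    term of index k. *)
Variables (u : {poly K}) (a b M k : nat).
Hypotheses (su : size u = 2) (a0 : (0 < a)%N) (b0 : (0 < b)%N) (k0 : (0 < k)%N).
Hypothesis sk : size f^`N(k) = M.+1.
Hypothesis sM : forall i, (0 < i)%N -> (size f^`N(i) <= M.+1)%N.
Let D0 := (f \Po u) - f.
Hypothesis e0 : D0 != 0 -> (a * (size D0).-1 + b * k <= a * M)%N.
Hypothesis ei : forall i, (0 < i < k)%N -> f^`N(i) != 0 ->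
  (a * (size f^`N(i)).-1 + b * (k - i) <= a * M)%N.
Hypothesis ex :
  (D0 != 0) && (a * (size D0).-1 + b * k == a * M)%N \/
  exists2 i, (0 < i < k)%N & (f^`N(i) != 0) &&
     (a * (size f^`N(i)).-1 + b * (k - i) == a * M)%N.
Let C := ((f \Po g) \Po u) - (f \Po g).
Hypothesis eC : [\/ C = 0, (Q * M < size C)%N
  | (a * (size C).-1 + b * k < a * (Q * M))%N].

Let coef_increment0 : (increment u)`_0 = D0.
Proof. by rewrite coefB coefC coef_taylor nderivn0. Qed.

Let coef_incrementS i : (0 < i)%N -> (increment u)`_i = f^`N(i) \Po u.
Proof. by move=> i0; rewrite coefB coefC coef_taylor gtn_eqF // subr0. Qed.

Let degM i : (0 < i)%N -> ((size f^`N(i)).-1 <= M)%N.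
Proof. by move=> /sM; case: (size _). Qed.

Let wk : (increment u)`_k != 0 /\
  weight a b (increment u)`_k k = (a * M)%:Z - (b * k)%:Z.
Proof.
rewrite coef_incrementS // comp_poly2_eq0 // -size_poly_eq0 /weight.
by rewrite size_comp_poly2 // sk.
Qed.

Let wle i : (increment u)`_i != 0 ->
  weight a b (increment u)`_i i <= weight a b (increment u)`_k k.
Proof.
rewrite wk.2; have [->|i0] := posnP i.
  rewrite coef_increment0 => /e0; rewrite /weight muln0.
  by move: (size _).-1 => d; clear; lia.
rewrite coef_incrementS // comp_poly2_eq0 // /weight size_comp_poly2 // => h.
have [lt|ge] := ltnP i k.
  have := ei _ h; rewrite i0 lt => /(_ isT).
  move: (size _).-1 => d; have -> : (b * (k - i) = b * k - b * i)%N by rewrite mulnBr.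
  have : (b * i <= b * k)%N by rewrite leq_mul2l ltnW ?orbT.
  by move: (b * i)%N (b * k)%N (a * d)%N (a * M)%N; clear; lia.
have : (a * (size f^`N(i)).-1 <= a * M)%N.
  by rewrite leq_mul2l degM ?orbT.
have : (b * k <= b * i)%N by rewrite leq_mul2l ge orbT.
by move: (b * i)%N (b * k)%N (a * _)%N (a * M)%N; clear; lia.
Qed.

Let term i n := (f^`N(i) \Po (g \Po u)) * ((L ^+ i)`_n)%:P.

Let deg_gu : (size (g \Po u)).-1 = Q.
Proof. by rewrite size_comp_poly size_g su muln1. Qed.

Let wterm i n : term i n != 0 ->
  weight a b (term i n) n = (a * (Q * (size f^`N(i)).-1))%:Z - (b * n)%:Z.
Proof.
rewrite /term mulf_eq0 negb_or => /andP[h1]; rewrite polyC_eq0 => h2.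
rewrite /weight mulrC mul_polyC size_scale // size_comp_poly deg_gu.
by rewrite (mulnC Q).
Qed.

Let term_nz i n : term i n != 0 -> f^`N(i) != 0.
Proof. by apply: contraNneq; rewrite /term => ->; rewrite comp_poly0 mul0r. Qed.

Let wterm_le i n : (0 < i)%N -> term i n != 0 ->
  weight a b (term i n) n <= (a * (Q * M))%:Z - (b * n)%:Z.
Proof.
move=> i0 h; rewrite wterm // lerD2r lez_nat !leq_mul2l.
by rewrite degM ?orbT.
Qed.

Let term0 n : (0 < n)%N -> term 0 n = 0.
Proof. by move=> n0; rewrite /term expr0 coefC gtn_eqF // mulr0. Qed.

Let wterm_lt i n : (0 < i < k)%N -> (i <= n)%N -> (n <= k)%N -> term i n != 0 ->
  weight a b (term i n) n < (a * (Q * M))%:Z - (b * k)%:Z.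
Proof.
move=> /[dup] hik /andP[i0 ik] ni nk h; rewrite wterm //.
have h2 := ei hik (term_nz h).
move: h2; move: (size _).-1 => d h2.
have h3 : (a * (Q * d) + Q * (b * (k - i)) <= a * (Q * M))%N.
  by rewrite !(mulnCA a) -mulnDr leq_mul2l h2 orbT.
have h4 : (b * (k - i) + b * (k - i) <= Q * (b * (k - i)))%N.
  by rewrite addnn -mul2n leq_mul2r Q_gt1 orbT.
have h5 : (b * (k - n) <= b * (k - i))%N by rewrite leq_mul2l leq_sub2l ?orbT.
have h6 : (0 < b * (k - i))%N by rewrite muln_gt0 b0 subn_gt0.
have h7 : (b * k = b * (k - n) + b * n)%N by rewrite -mulnDr subnK.
rewrite h7; move: h3 h4 h5 h6; clear.
move: (b * (k - i))%N (b * (k - n))%N (a * (Q * d))%N (Q * _)%N (a * _)%N (b * n)%N => x y z t w r.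
by lia.
Qed.

(** For n < k the gap b (k - i) between weights has been multiplied by Q >= 2. *)
Let wg_lt n : (0 < n)%N -> n != k -> (image_increment u)`_n != 0 ->
  weight a b (image_increment u)`_n n < (a * (Q * M))%:Z - (b * k)%:Z.
Proof.
move=> n0 nk; rewrite coef_image_increment //; apply: weight_sum => i _ h.
have [i0|i0] := posnP i; first by move: h; rewrite i0 -/(term 0 n) term0 ?eqxx.
have [lt|ge] := ltnP n k.
  have lein : (i <= n)%N by rewrite -ltnS.
  apply: wterm_lt => //; last exact: ltnW.
  by rewrite i0 (leq_ltn_trans lein lt).
have {}ge : (k < n)%N by rewrite ltn_neqAle eq_sym nk.
apply: le_lt_trans (wterm_le i0 h) _.
by rewrite ltrD2l ltrN2 ltz_nat ltn_mul2l b0.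
Qed.

(** For eps^k, the only way to reach full degree is to take the linear term of L in each of the
    k factors. *)
Let wg_k : (image_increment u)`_k != 0 /\
  weight a b (image_increment u)`_k k = (a * (Q * M))%:Z - (b * k)%:Z.
Proof.
rewrite coef_image_increment // big_ord_recr /= addrC -/(term k k).
have tk : term k k != 0.
  rewrite /term coef_additive_expr_diag mulf_neq0 ?polyC_eq0 ?expf_neq0 //.
  rewrite comp_poly_eq0 -?size_poly_eq0 ?sk //.
  by move: deg_gu Q_gt1; case: (size _) => [|[|s]] //= <-.
have wtk : weight a b (term k k) k = (a * (Q * M))%:Z - (b * k)%:Z.
  by rewrite wterm // sk.
rewrite -wtk; apply: weight_dominant => //.
rewrite wtk; apply: weight_sum => i _ h.
have [i0|i0] := posnP i; first by move: h; rewrite i0 -/(term 0 k) term0 ?eqxx.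
by apply: wterm_lt => //; rewrite ?i0 /= ?ltn_ord // ltnW.
Qed.

(** The leading form of f(g(u) + L(eps)) - f(g) consists of a single term, at index k or at index 0,
    although that of its divisor f(u + eps) - f has at least two. *)
Lemma semiconj_no_edge : False.
Proof.
have [S eS] := increment_dvd_image u; have [nk wk2] := wk.
have key i0 : (image_increment u)`_i0 != 0 ->
    (forall i, i != i0 -> (image_increment u)`_i != 0 ->
     weight a b (image_increment u)`_i i < weight a b (image_increment u)`_i0 i0) -> False.
  rewrite eS => h1 h2; case: ex => [/andP[h3 /eqP h4]|[i /andP[i0' ik] /andP[h3 /eqP h4]]].
    apply: (edge_not_factor a0 nk (i2 := 0) _ _ _ wle h1 h2).
    - by rewrite coef_increment0.
    - by rewrite gtn_eqF.
    - by rewrite wk2 coef_increment0 /weight muln0 -h4 PoszD addrK subr0.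
  apply: (edge_not_factor a0 nk (i2 := i) _ _ _ wle h1 h2).
  - by rewrite coef_incrementS // comp_poly2_eq0.
  - by rewrite gtn_eqF.
  rewrite wk2 coef_incrementS // /weight size_comp_poly2 // -h4 mulnBr.
  have : (b * i <= b * k)%N by rewrite leq_mul2l ltnW ?orbT.
  by move: (b * i)%N (b * k)%N (a * _)%N; clear; lia.
have small : (C != 0 -> (a * (size C).-1 + b * k < a * (Q * M))%N) -> False.
  move=> hC; apply: (key k wg_k.1) => n nk' hn; rewrite wg_k.2.
  have [n0|n0] := posnP n; last exact: wg_lt.
  move: hn; rewrite n0 coef_image_increment0 -/C => /hC; rewrite /weight muln0.
  by move: (a * _)%N (b * k)%N (a * _)%N; clear; lia.
case: eC => [C0|C0|C0]; [by apply: small; rewrite C0 eqxx | | exact: small].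
have nC : C != 0 by rewrite -size_poly_gt0; apply: leq_ltn_trans C0.
apply: (key 0%N); rewrite coef_image_increment0 -/C // => n n0 hn.
rewrite /weight muln0 subr0 -/(weight a b _ n).
have h : (a * (Q * M) <= a * (size C).-1)%N.
  by rewrite leq_mul2l; apply/orP; right; move: C0; case: (size C).
have n0' : (0 < n)%N by rewrite lt0n.
apply: (@lt_le_trans _ _ (a * (Q * M))%:Z); last by rewrite lez_nat.
have [->|nk'] := eqVneq n k.
  by rewrite wg_k.2 ltrBlDr ltrDl ltz_nat muln_gt0 b0 k0.
apply: lt_trans (wg_lt n0' nk' hn) _.
by rewrite ltrBlDr ltrDl ltz_nat muln_gt0 b0 k0.
Qed.

End Semiconj.

(** * Auxiliary facts on extrema, divided derivatives and binomials *)

Lemma exists_max (T : Type) (P : T -> Prop) (F : T -> nat) (N : nat) :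
  (exists x, P x) -> (forall x, P x -> (F x <= N)%N) ->
  exists2 x, P x & forall y, P y -> (F y <= F x)%N.
Proof.
move=> [x0 Px0] hN; pose A n := `[< exists2 x, P x & F x = n >].
have exA : exists n, A n by exists (F x0); apply/asboolP; exists x0.
have ubA n : A n -> (n <= N)%N by move=> /asboolP[x Px <-]; apply: hN.
case: (ex_maxnP exA ubA) => m /asboolP[x Px <-] hm; exists x => // y Py.
by apply: hm; apply/asboolP; exists y.
Qed.

Lemma size_nderivn_le (R : nzSemiRingType) (p : {poly R}) n :
  (size p^`N(n) <= size p - n)%N.
Proof.
apply/leq_sizeP => i hi; rewrite coef_nderivn nth_default ?mul0rn //.
by rewrite -leq_subLR.
Qed.

Lemma comp_XaddC_nderivn (R : comNzRingType) (p : {poly R}) t :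
  p \Po ('X + t%:P) = \sum_(i < size p) t ^+ i *: p^`N(i).
Proof.
rewrite /comp_poly (nderiv_taylor p^:P (_ : GRing.comm 'X t%:P)) ?size_map_polyC; last exact: mulrC.
apply: eq_bigr => i _; rewrite nderivn_map -/(comp_poly 'X _) comp_polyXr.
by rewrite -rmorphXn /= mulrC mul_polyC.
Qed.

(** The d-th roots of unity are d in number, as d is invertible, too many to be roots of
    X^i - 1. *)
Lemma exists_unity_root (K : closedFieldType) (d i : nat) :
  d%:R != 0 :> K -> (0 < i < d)%N -> exists2 z : K, z ^+ d = 1 & z ^+ i != 1.
Proof.
move=> d0 /andP[i0 lid].
have m : ('X^d - 1%:P : {poly K}) \is monic.
  by rewrite monicE lead_coefXnsubC // (ltn_trans i0).
have [r er] := closed_field_poly_normal ('X^d - 1%:P : {poly K}).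
rewrite (monicP m) scale1r in er.
have ur : uniq r.
  rewrite -separable_prod_XsubC -er separable_poly.unlock; apply/Bezout_coprimepP.
  exists (- 1, d%:R^-1 *: 'X) => /=.
  have -> : (d%:R^-1 *: 'X) * ('X^d - 1%:P)^`() = 'X^d :> {poly K}.
    rewrite derivB derivC subr0 derivXn mulrnAr -scalerAl -exprS.
    by rewrite prednK ?(ltn_trans i0) // -scaler_nat scalerA mulfV // scale1r.
  by rewrite mulN1r opprB subrK eqpxx.
have sr : size r = d.
  have := size_prod_XsubC r (fun x => x); rewrite -er size_XnsubC ?(ltn_trans i0) //.
  by case.
have rr z : z \in r -> z ^+ d = 1.
  rewrite -root_prod_XsubC -er /root !hornerE subr_eq0 => /eqP //.
case: (boolP (all (root ('X^i - 1%:P)) r)) => [h|/allPn[z zr]].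
  have p0 : ('X^i - 1%:P : {poly K}) != 0 by rewrite -size_poly_eq0 size_XnsubC.
  have := max_poly_roots p0 h ur; rewrite size_XnsubC // sr ltnS leqNgt.
  by rewrite lid.
rewrite /root !hornerE subr_eq0 => hz; exists z => //; exact: rr.
Qed.

(** With N the p-part of d and d = N e, the expansion of (X + 1)^d = (X^N + 1)^e has coefficient
    e at X^N. *)
Lemma binomial_p_part_neq0 (K : fieldType) (p d : nat) :
  p \in [pchar K] -> (0 < d)%N -> 'C(d, (d`_p)%N)%:R != 0 :> K.
Proof.
move=> pK d0; set N := (d`_p)%N; set e := (d`_p^')%N.
have dE : d = (N * e)%N by rewrite partnC.
have N0 : (0 < N)%N by rewrite part_gt0.
have nN : [pchar K].-nat N.
  by rewrite (eq_pnat _ (pcharf_eq pK)) part_pnat.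
have coef1 n i : ((('X + 1) ^+ n : {poly K})`_i) = 'C(n, i)%:R.
  rewrite exprD1n coef_sum.
  under eq_bigr do rewrite coefMn coefXn.
  have [lt|ge] := ltnP i n.+1.
    rewrite (bigD1 (Ordinal lt)) //= eqxx big1 ?addr0 // => j.
    by rewrite -val_eqE /= eq_sym => /negPf ->; rewrite mul0rn.
  rewrite bin_small // big1 // => j _.
  by rewrite gtn_eqF ?mul0rn // (leq_trans (ltn_ord j)).
rewrite -coef1 {1}dE exprM exprDn_pchar; last first.
  by move: nN; rewrite (eq_pnat N (pchar_lalg _)).
rewrite expr1n.
have -> : ('X^N + 1 : {poly K}) ^+ e = (('X + 1) ^+ e) \Po 'X^N.
  by rewrite rmorphXn /= comp_polyD comp_polyX comp_polyC.
rewrite coef_comp_poly_Xn // dvdnn divnn N0 coef1 bin1 -pcharf'_nat.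
by rewrite (eq_pnat _ (eq_negn (pcharf_eq pK))) part_pnat.
Qed.

(** * Semiconjugacies without translation symmetry have degree prime to p *)

(** Seen from the point (k, M), the slope (M - d i) / (k - i) is least at i0. *)
Lemma exists_least_slope (k M : nat) (d : nat -> nat) (A : pred nat) :
  (exists2 i, (0 < i < k)%N & A i) ->
  (forall i, (0 < i < k)%N -> A i -> (d i < M)%N) ->
  exists i0, [/\ (0 < i0 < k)%N, A i0 &
    forall i, (0 < i < k)%N -> A i ->
     ((k - i0) * d i + (M - d i0) * (k - i) <= (k - i0) * M)%N].
Proof.
move=> [i1 /andP[h1 h2] h3] hd.
pose F (i : 'I_k) : rat := (M - d i)%:R / (k - i)%:R.
pose P (i : 'I_k) := (0 < i)%N && A i.
have P1 : P (Ordinal h2) by rewrite /P /= h1.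
have [i0 /andP[p1 p2] hi] := @arg_minP _ rat _ _ P F P1.
exists i0; split=> //; first by rewrite p1 ltn_ord.
move=> i /andP[q1 q2] q3.
have := hi (Ordinal q2); rewrite /P /= q1 q3 => /(_ isT).
have k0 : 0 < (k - i0)%:R :> rat by rewrite ltr0n subn_gt0.
have ki : 0 < (k - i)%:R :> rat by rewrite ltr0n subn_gt0.
rewrite /F /= ler_pdivrMr // mulrAC ler_pdivlMr // -!natrM ler_nat => h.
have := hd _ _ q3; rewrite q1 q2 => /(_ isT) lt.
rewrite (leq_trans (leq_add (leqnn _) h)) // mulnC -mulnDl.
by rewrite subnKC ?(ltnW lt) // mulnC.
Qed.

Section Rigid.
Variables (K : closedFieldType) (p : nat) (L : {poly K}) (Q : nat) (delta : K).
Variables (f psi : {poly K}).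
Hypotheses (addL : additive_poly L) (L1 : L`_1 != 0) (sL : size L = Q.+1).
Hypothesis (Q_gt1 : (1 < Q)%N).
Let g := L + delta%:P.
Hypothesis semi : f \Po g = psi \Po f.
Hypothesis df : f^`() != 0.

Let deg_comp_g (h : {poly K}) : (size (h \Po g)).-1 = ((size h).-1 * Q)%N.
Proof. by rewrite size_comp_poly (size_g delta sL Q_gt1). Qed.

Lemma size_nderivn_max : exists M, [/\ (0 < M)%N,
   forall i, (0 < i)%N -> (size f^`N(i) <= M)%N &
   exists2 i, (0 < i)%N & size f^`N(i) = M].
Proof.
have [||i i0 hi] := @exists_max nat (fun i => (0 < i)%N) (fun i => size f^`N(i)) (size f).
- by exists 1%N.
- by move=> i _; rewrite (leq_trans (size_nderivn_le _ _)) // leq_subr.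
exists (size f^`N(i)); split=> //; last by exists i.
by apply: leq_trans (hi 1%N isT); rewrite nderivn1 size_poly_gt0.
Qed.

(** Otherwise the first index k of maximal degree is at least 2, and the increment
    f(x + eps) - f(x) has an edge of positive slope that ends at k; its constant term is 0, which
    makes [semiconj_no_edge] applicable with u = X. *)
Lemma deriv_max i : (0 < i)%N -> (size f^`N(i) <= size f^`())%N.
Proof.
have [M [M0 hM ex]] := size_nderivn_max.
suff -> : size f^`() = M by exact: hM.
have exk : exists i, (0 < i)%N && (size f^`N(i) == M).
  by have [k k0 kM] := ex; exists k; rewrite k0 kM eqxx.
case: (ex_minnP exk) => k /andP[k0 /eqP kM] kmin.
have [k1|] := eqVneq k 1%N; first by rewrite -nderivn1 -k1.
move=> k1; have {}k1 : (1 < k)%N by rewrite ltn_neqAle eq_sym k1.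
have lt i' : (0 < i' < k)%N -> f^`N(i') != 0 -> ((size f^`N(i')).-1 < M.-1)%N.
  move=> /andP[i0 ik] n0; have := hM i' i0; rewrite leq_eqVlt => /orP[/eqP e|].
    by have := kmin i'; rewrite i0 e eqxx leqNgt ik => /(_ isT).
  by move: n0; rewrite -size_poly_gt0; case: (size _) => // s _; case: (M).
have [|//|i0 [h1 h2 h3]] := @exists_least_slope k M.-1 (fun i => (size f^`N(i)).-1)
   (fun i => f^`N(i) != 0).
  by exists 1%N; rewrite ?nderivn1 // k1.
have lt0 := lt _ h1 h2.
exfalso; apply: (@semiconj_no_edge K L Q delta f psi addL L1 sL Q_gt1 semi 'X
   (k - i0) (M.-1 - (size f^`N(i0)).-1) M.-1 k).
- by rewrite size_polyX.
- by rewrite subn_gt0; case/andP: h1.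
- by rewrite subn_gt0.
- by [].
- by rewrite prednK.
- by rewrite prednK.
- by rewrite comp_polyXr subrr eqxx.
- exact: h3.
- right; exists i0; rewrite // h2 /= mulnC -mulnDl subnKC ?(ltnW lt0) //.
  by rewrite mulnC.
- by constructor 1; rewrite comp_polyXr subrr.
Qed.

Let M := (size f^`()).-1.
Let sM : size f^`N(1) = M.+1.
Proof. by rewrite nderivn1 prednK // size_poly_gt0. Qed.

(** A family of substitutions u x whose defects f(u x) - f have degree less than that of f', and
    whose defects g carries to defects of the same family, to zero or to something large,
    consists of symmetries of f: otherwise the largest nonzero defect gives an edge from index 0
    to index k = 1 whose slope is the least in the family. *)
Lemma small_defect_vanishes (T : Type) (P : T -> Prop) (u : T -> {poly K}) :
  (forall x, P x -> size (u x) = 2) ->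
  let D x := (f \Po u x) - f in
  (forall x, P x -> (size (D x) <= M)%N) ->
  (forall x, P x ->
    let C := (f \Po g \Po u x) - (f \Po g) in
    [\/ (M * Q < size C)%N, C = 0 | exists2 y, P y & C = D y \Po g]) ->
  forall x, P x -> f \Po u x = f.
Proof.
move=> su D hD hC x0 Px0; apply/eqP; rewrite -subr_eq0; apply/negPn/negP => D0.
have [||x [Px Dx] hx] := @exists_max T (fun x => P x /\ D x != 0) (fun x => size (D x)) M.
- by exists x0.
- by move=> x [Px _]; apply: hD.
have sx : (0 < size (D x))%N by rewrite size_poly_gt0.
have lt : ((size (D x)).-1 < M)%N by rewrite prednK // hD.
apply: (@semiconj_no_edge K L Q delta f psi addL L1 sL Q_gt1 semi (u x)
   1 (M - (size (D x)).-1) M 1).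
- exact: su.
- by [].
- by rewrite subn_gt0.
- by [].
- exact: sM.
- by move=> i i0; rewrite -sM nderivn1 deriv_max.
- by move=> _; rewrite mul1n muln1 mul1n subnKC // ltnW.
- by case=> [|i].
- by left; rewrite -/(D x) Dx mul1n muln1 mul1n subnKC ?eqxx // ltnW.
case: (hC x Px) => [h|h|[y Py h]].
- by constructor 2; rewrite mulnC.
- by constructor 1.
have [Dy|Dy] := eqVneq (D y) 0; first by constructor 1; rewrite h Dy comp_poly0.
constructor 3; rewrite h mul1n muln1 mul1n deg_comp_g.
have le : ((size (D y)).-1 <= (size (D x)).-1)%N.
  by rewrite -!subn1 leq_sub2r // hx.
move: lt le Q_gt1; move: (size (D x)).-1 (size (D y)).-1 M; clear.
move=> a b m h1 h2 h3.
have -> : (Q * m = Q * (m - a) + Q * a)%N by rewrite -mulnDr subnK // ltnW.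
have h4 : (b * Q <= Q * a)%N by rewrite mulnC leq_mul2l h2 orbT.
have h5 : (2 * (m - a) <= Q * (m - a))%N by rewrite leq_mul2r h3 orbT.
by rewrite addnC (leq_trans _ (leq_add h5 h4)) // ltn_add2r mul2n -addnn -addn1 leq_add2l subn_gt0.
Qed.

Hypothesis no_trans : forall t, f \Po ('X + t%:P) = f -> t = 0.

Let defect t := (f \Po ('X + t%:P)) - f.

Let translate_defect t : defect t =
  \sum_(i < size f | i != 0 :> nat) t ^+ i *: f^`N(i).
Proof.
have f0 : f != 0 by apply: contraNneq df => ->; rewrite deriv0.
rewrite /defect comp_XaddC_nderivn.
have sf : (0 < size f)%N by rewrite size_poly_gt0.
by rewrite (bigD1 (Ordinal sf)) //= expr0 scale1r nderivn0 addrAC subrr add0r.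
Qed.

Let size_translate t : (size (defect t) <= M.+1)%N.
Proof.
rewrite translate_defect; apply: (leq_trans (size_sum _ _ _)).
apply/bigmax_leqP => i i0; apply: (leq_trans (size_scale_leq _ _)).
by rewrite -sM nderivn1 deriv_max // lt0n.
Qed.

Let comp_g_translate t : f \Po g \Po ('X + t%:P) = f \Po ('X + L.[t]%:P) \Po g.
Proof.
rewrite -!comp_polyA; congr (_ \Po _); apply: poly_ext => x.
by rewrite /g !(horner_comp, hornerE) addL addrAC.
Qed.

(** If some f^`N(i) with i > 1 had the degree M of f', the coefficient of x^M in f(x + t) - f(x)
    would be a polynomial T in t with two terms of positive degree.  A nonzero root t of T is a
    translation of small defect, hence a symmetry of f. *)
Lemma deriv_strict_max i : (1 < i)%N -> (size f^`N(i) < size f^`())%N.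
Proof.
move=> i1; rewrite ltn_neqAle deriv_max ?(ltnW i1) // andbT; apply/eqP => si.
have f0 : f != 0 by apply: contraNneq df => ->; rewrite deriv0.
pose T := \poly_(i < size f) (if i == 0%N then 0 else (f^`N(i))`_M).
have Tt t : T.[t] = (defect t)`_M.
  rewrite translate_defect coef_sum horner_poly [RHS]big_mkcond.
  apply: eq_bigr => k _; case: eqP => //= _; first by rewrite mul0r.
  by rewrite coefZ mulrC.
have lf k : (0 < k)%N -> size f^`N(k) = M.+1 -> T`_k != 0.
  move=> k0 sk; rewrite coef_poly; case: ltnP => h; last first.
    have := size_nderivn_le f k; rewrite sk; have -> : (size f - k = 0)%N.
      by apply/eqP; rewrite subn_eq0.
    by [].
  by rewrite gtn_eqF // -[M]/(M.+1.-1) -sk -/(lead_coef _) lead_coef_eq0 -size_poly_eq0 sk.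
have T1 := lf 1%N isT sM.
have Ti : T`_i != 0 by apply: lf; rewrite ?(ltnW i1) // si -nderivn1.
have rT : root T 0.
  by rewrite /root horner_coef0 coef_poly; case: ifP.
have [T' eT] := factor_theorem _ _ rT; rewrite subr0 in eT.
have sT' : size T' != 1%N.
  apply: contraNneq Ti => /eqP/size_poly1P[c _ ec].
  by rewrite eT ec coefMX coefC; case: (i) i1 => [|[|]].
have /closed_rootP[t T't] := sT'.
have t0 : t != 0.
  apply: contraNneq T1 => e0; move: T't; rewrite e0 /root horner_coef0.
  by rewrite eT coefMX.
suff /no_trans/eqP : f \Po ('X + t%:P) = f by rewrite (negPf t0).
apply: (@small_defect_vanishes K (fun t => size (defect t) <= M)%N
   (fun t => 'X + t%:P)) => [x _|//|x hx C|].
- by rewrite size_XaddC.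
- rewrite /C comp_g_translate -comp_polyB.
  have [h|h] := leqP (size (defect L.[x])) M.
    by constructor 3; exists L.[x].
  constructor 1; have e : (size (defect L.[x])).-1 = M.
    by apply/eqP; rewrite eqn_leq -ltnS (leq_trans _ (size_translate L.[x])) ?leqSpred //= -ltnS prednK // (leq_ltn_trans _ h).
  rewrite -e -deg_comp_g prednK // size_poly_gt0 comp_poly_eq0.
    by rewrite -size_poly_gt0 (leq_ltn_trans _ h).
  by rewrite (size_g delta sL Q_gt1) ltnS ltnW.
- apply/leq_sizeP => k; rewrite leq_eqVlt => /orP[/eqP <-|h].
    by rewrite -Tt eT hornerM (rootP T't) mul0r.
  by rewrite nth_default // (leq_trans (size_translate t)).
Qed.

Hypothesis pK : p \in [pchar K].

(** The derivative of L is constant, so that Q times its leading coefficient is 0. *)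
Lemma pchar_deg_additive : (p %| Q)%N.
Proof.
rewrite (dvdn_pcharf pK); have := additive_nderivn addL (isT : (0 < 1)%N).
rewrite nderivn1 => /polyP/(_ Q.-1); rewrite coef_deriv coefC.
have -> : (Q.-1 == 0)%N = false by case: (Q) Q_gt1 => [|[|]].
rewrite prednK ?(ltnW Q_gt1) //  /= => /eqP.
rewrite -[_ *+ Q]mulr_natr mulf_eq0 => /orP[|//].
by rewrite -[Q in L`_Q]/(Q.+1.-1) -sL -/(lead_coef L) lead_coef_eq0 -size_poly_eq0 sL.
Qed.

(** Let N be the p-part of d = deg f and M = deg f'.  Degrees in f'(g) L_1 = psi'(f) f' show that
    d divides (Q - 1) M, and p divides Q, so N divides M and M <= d - N; but f^`N(N) has degree
    d - N because C(d, N) is nonzero in K, against [deriv_strict_max]. *)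
Lemma deg_coprime : ~~ (p %| (size f).-1)%N.
Proof.
set d := (size f).-1; apply/negP => pd.
have f0 : f != 0 by apply: contraNneq df => ->; rewrite deriv0.
have sf : size f = d.+1 by rewrite prednK // size_poly_gt0.
have p_pr := pcharf_prime pK.
have d0 : (0 < d)%N.
  rewrite lt0n; apply: contraNneq df => e; have /eqP := sf; rewrite e.
  by case/size_poly1P => c _ ->; rewrite derivC.
set N := (d`_p)%N.
have N1 : (1 < N)%N.
  by rewrite p_part_gt1 mem_primes p_pr d0 pd.
have Nd : (N %| d)%N by exact: dvdn_part.
have dg : g^`() = (L`_1)%:P.
  by rewrite derivD derivC addr0 -nderivn1 additive_nderivn.
have sM' : (size f^`()).-1 = M by [].
have eM : (M * Q = (size psi^`()).-1 * d + M)%N.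
  have := congr1 deriv semi; rewrite !deriv_comp dg => e.
  have psi0 : psi^`() != 0.
    apply: contraNneq df => h; move: e; rewrite h comp_poly0 mul0r.
    move/eqP; rewrite mulf_eq0 polyC_eq0 (negPf L1) orbF comp_poly_eq0 //.
    by rewrite (size_g delta sL Q_gt1) ltnS ltnW.
  have psif0 : psi^`() \Po f != 0 by rewrite comp_poly_eq0 // sf ltnS.
  have := congr1 (fun q : {poly K} => (size q).-1) e.
  rewrite mulrC mul_polyC size_scale // deg_comp_g size_mul // => ->.
  rewrite -/d -size_comp_poly -/M.
  have := size_poly_gt0 (psi^`() \Po f); have := size_poly_gt0 f^`().
  rewrite psif0 df /M; move: (size _) (size _); clear => x y; lia.
have NM : (N %| M)%N.
  have : (N %| M * (Q - 1))%N.
    rewrite mulnBr muln1 eM addnK; exact: dvdn_mull.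
  rewrite Gauss_dvdl // /N p_part coprime_pexpl ?logn_gt0 ?mem_primes ?p_pr ?d0 ?pd //.
  rewrite prime_coprime //; apply/negP => h.
  have := pchar_deg_additive; rewrite -(subnKC (ltnW Q_gt1)) dvdn_addl //.
  by rewrite dvdn1 => /eqP e; rewrite e in p_pr.
have Md : (M < d)%N.
  have := lt_size_deriv f0; rewrite sf /M => h.
  by have := size_poly_gt0 f^`(); rewrite df; move: h; case: (size _).
have MN : (M <= d - N)%N.
  have [/dvdnP[x ex] /dvdnP[y ey]] := (NM, Nd).
  rewrite ex ey -{3}(mul1n N) -mulnBl leq_mul2r; apply/orP; right.
  by move: Md; rewrite ex ey ltn_mul2r => /andP[_]; case: y {ey} => // y; rewrite subn1 ltnS.
have := deriv_strict_max N1; rewrite -nderivn1 sM ltnS => h.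
have : (size f^`N(N) <= d - N)%N by apply: leq_trans h MN.
move/leq_sizeP/(_ _ (leqnn _)); rewrite coef_nderivn subnKC ?(dvdn_leq _ Nd) //.
rewrite -mulr_natr; apply/eqP; rewrite mulf_neq0 //.
  by rewrite /d -/(lead_coef f) lead_coef_eq0.
exact: binomial_p_part_neq0.
Qed.

End Rigid.

(** * Semiconjugacies of degree prime to p *)

(** The hypothesis [fd1] centres f, so that a rotation by a d-th root of unity changes f only in
    degrees at most d - 2. *)
Section Tame.
Variables (K : closedFieldType) (L : {poly K}) (Q : nat) (delta : K).
Variables (f psi : {poly K}) (d : nat).
Hypotheses (addL : additive_poly L) (L1 : L`_1 != 0) (sL : size L = Q.+1).
Hypothesis (Q_gt1 : (1 < Q)%N).
Let g := L + delta%:P.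
Hypothesis semi : f \Po g = psi \Po f.
Hypotheses (sf : size f = d.+1) (d0 : d%:R != 0 :> K).
Hypothesis fd1 : f`_d.-1 = 0.

Let d_gt0 : (0 < d)%N.
Proof. by case: (d) d0 => [|//]; rewrite eqxx. Qed.

Let fd : f`_d != 0.
Proof. by rewrite -[d]/(d.+1.-1) -sf -/(lead_coef f) lead_coef_eq0 -size_poly_eq0 sf. Qed.

Lemma size_deriv_tame : size f^`() = d.
Proof.
apply/eqP; rewrite eqn_leq; apply/andP; split.
  by rewrite -ltnS -sf lt_size_deriv // -size_poly_eq0 sf.
rewrite leqNgt; apply/negP => h; have : f^`()`_d.-1 = 0.
  by rewrite nth_default // -ltnS prednK.
by rewrite coef_deriv prednK // -mulr_natr => /eqP; rewrite mulf_eq0 (negPf d0) (negPf fd).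
Qed.

Let df : f^`() != 0.
Proof. by rewrite -size_poly_eq0 size_deriv_tame -lt0n. Qed.

Lemma coef_comp_scaleX (z : K) i : (f \Po (z *: 'X))`_i = f`_i * z ^+ i.
Proof.
rewrite comp_polyE coef_sum; under eq_bigr do rewrite exprZn scalerA coefZ coefXn.
have [lt|ge] := ltnP i (size f).
  rewrite (bigD1 (Ordinal lt)) //= eqxx mulr1 big1 ?addr0 // => j.
  by rewrite -val_eqE /= eq_sym => /negPf ->; rewrite mulr0.
rewrite nth_default // mul0r big1 // => j _.
by rewrite gtn_eqF ?mulr0 // (leq_trans (ltn_ord j)).
Qed.

Let scaled_defect z := (f \Po (z *: 'X)) - f.

Let size_scaled_defect z : z ^+ d = 1 -> (size (scaled_defect z) <= d.-1)%N.
Proof.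
move=> zd; rewrite /scaled_defect; apply/leq_sizeP => i; rewrite coefB coef_comp_scaleX.
rewrite leq_eqVlt => /orP[/eqP <-|]; first by rewrite fd1 mul0r subr0.
rewrite prednK // leq_eqVlt => /orP[/eqP <-|h]; first by rewrite zd mulr1 subrr.
by rewrite nth_default ?mul0r ?subr0 // sf.
Qed.

Let sg : size g = Q.+1.
Proof. exact: size_g. Qed.

Let f1 := f - f`_d *: 'X^d.
Let size_f1 : (size f1 <= d.-1)%N.
Proof.
apply/leq_sizeP => i; rewrite coefB coefZ coefXn.
rewrite leq_eqVlt => /orP[/eqP <-|].
  by rewrite fd1 ltn_eqF ?mulr0 ?subr0 // prednK.
rewrite prednK // leq_eqVlt => /orP[/eqP <-|h].
  by rewrite eqxx mulr1 subrr.
by rewrite gtn_eqF // mulr0 nth_default ?subr0 // sf.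
Qed.

Let f_comp h : f \Po h = f`_d *: h ^+ d + (f1 \Po h).
Proof.
by rewrite /f1 comp_polyB comp_polyZ rmorphXn /= comp_polyX addrC subrK.
Qed.

(** All d summands have the same leading coefficient, and d is nonzero in K. *)
Lemma size_sum_expr (x y : {poly K}) :
  size x = Q.+1 -> size y = Q.+1 -> lead_coef x = lead_coef y ->
  size (\sum_(i < d) x ^+ (d.-1 - i) * y ^+ i) = (d.-1 * Q).+1.
Proof.
move=> sx sy lxy; set s := \sum_(_ < _) _.
have x0 : x != 0 by rewrite -size_poly_eq0 sx.
have y0 : y != 0 by rewrite -size_poly_eq0 sy.
have szt (i : 'I_d) : size (x ^+ (d.-1 - i) * y ^+ i) = (d.-1 * Q).+1.
  rewrite size_mul ?expf_neq0 //.
  have sX (q : {poly K}) n : size q = Q.+1 -> size (q ^+ n) = (n * Q).+1.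
    move=> sq; have q0 : q != 0 by rewrite -size_poly_eq0 sq.
    by rewrite -[LHS]prednK ?size_poly_gt0 ?expf_neq0 // size_exp sq mulnC.
  rewrite !sX // addSn addnS /= -mulnDl subnK //.
  by rewrite -ltnS prednK.
apply/eqP; rewrite eqn_leq; apply/andP; split.
  by apply: (leq_trans (size_sum _ _ _)); apply/bigmax_leqP => i _; rewrite szt.
rewrite ltnNge; apply/negP => /leq_sizeP/(_ _ (leqnn _)).
rewrite coef_sum (eq_bigr (fun=> lead_coef x ^+ d.-1)) => [|i _]; last first.
  rewrite -[(d.-1 * Q)%N]/((d.-1 * Q).+1.-1) -(szt i) -/(lead_coef _).
  rewrite lead_coefM !lead_coef_exp -lxy -exprD subnK //.
  by rewrite -ltnS prednK.
rewrite sumr_const card_ord -mulr_natr => /eqP.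
by rewrite mulf_eq0 (negPf d0) orbF expf_eq0 lead_coef_eq0 (negPf x0) andbF.
Qed.

Let unity_neq0 (x : K) : x ^+ d = 1 -> x != 0.
Proof.
move/eqP => xd; apply: contraTneq xd => ->.
by rewrite expr0n gtn_eqF // eq_sym oner_eq0.
Qed.

(** If g(x X) = x^Q g, the defect for x is carried by g to the defect for x^Q.  Otherwise the
    factorization of h1^d - h2^d shows that the image of the defect is large. *)
Lemma rotation_symmetry z : z ^+ d = 1 -> f \Po (z *: 'X) = f.
Proof.
have M1 : (size f^`()).-1 = d.-1 by rewrite size_deriv_tame.
apply: (@small_defect_vanishes K L Q delta f psi addL L1 sL Q_gt1 semi df K
  (fun z => z ^+ d = 1) (fun z => z *: 'X)) => [x xd|x xd|x xd C].
- have x0 := unity_neq0 xd.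
  by rewrite size_scale // size_polyX.
- by rewrite M1 size_scaled_defect.
rewrite M1; have x0 := unity_neq0 xd.
pose h1 := g \Po (x *: 'X); pose y := x ^+ Q; pose h2 := y *: g.
have y0 : y != 0 by rewrite expf_neq0.
have yd : y ^+ d = 1 by rewrite -exprM mulnC exprM xd expr1n.
have sh1 : size h1 = Q.+1 by rewrite size_comp_poly2 // size_scale // size_polyX.
have sh2 : size h2 = Q.+1 by rewrite size_scale.
have lh : lead_coef h1 = lead_coef h2.
  rewrite lead_coef_comp ?size_scale ?size_polyX // !lead_coefZ lead_coefX mulr1.
  by rewrite sg mulrC.
have [e|ne] := eqVneq h1 h2.
  constructor 3; exists y => //; rewrite comp_polyB -!comp_polyA.
  congr (_ - _); rewrite /C -comp_polyA -/h1 e; congr (_ \Po _).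
  by rewrite comp_polyZ comp_polyX.
have [d1|d2] := leqP d 1.
  have e1 : d = 1%N by apply/eqP; rewrite eqn_leq d1.
  by constructor 2; rewrite /C; move: xd; rewrite e1 expr1 => ->; rewrite scale1r comp_polyXr subrr.
constructor 1.
have eC : C = f`_d *: (h1 ^+ d - h2 ^+ d) + ((f1 \Po h1) - (f1 \Po g)).
  rewrite /C -comp_polyA -/h1 !f_comp /h2 exprZn yd scale1r scalerBr opprD.
  by rewrite addrACA.
have s1 : (d.-1 * Q < size (f`_d *: (h1 ^+ d - h2 ^+ d)))%N.
  rewrite size_scale // -{1}(prednK d_gt0) -{1}(prednK d_gt0) subrXX.
  have := size_sum_expr sh1 sh2 lh; rewrite (prednK d_gt0) => ss.
  rewrite size_mul ?subr_eq0 // -?size_poly_eq0 ?ss //.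
  have nz : h1 - h2 != 0 by rewrite subr_eq0.
  have := size_poly_gt0 (h1 - h2); rewrite nz.
  by case: (size _) => // n _; rewrite addSn /= addnS ltnS leq_addl.
have s2 (h : {poly K}) : size h = Q.+1 -> (size (f1 \Po h)%R <= d.-1 * Q)%N.
  move=> sh; apply: (leq_trans (size_comp_poly_leq _ _)); rewrite sh /=.
  have le : ((size f1).-1 <= d.-2)%N by move: size_f1; case: (size f1) => [|s] //=; case: (d.-1).
  have -> : d.-1 = d.-2.+1 by rewrite prednK // -ltnS prednK.
  by rewrite mulSn addnC -addn1 leq_add ?leq_mul2r ?le ?orbT // ltnW.
rewrite eC size_polyDl //; apply: leq_ltn_trans s1.
by rewrite (leq_trans (size_polyD _ _)) // size_polyN geq_max !s2.
Qed.

Lemma tame_monomial : f = f`_d *: 'X^d + (f`_0)%:P.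
Proof.
apply/polyP => i; rewrite coefD coefZ coefXn coefC.
have [->|i0] := posnP i; first by rewrite ltn_eqF // mulr0 add0r.
rewrite addr0; have [->|ne] := eqVneq i d; first by rewrite mulr1.
rewrite mulr0; have [lt|ge] := ltnP i d; last first.
  by rewrite nth_default // sf ltn_neqAle eq_sym ne.
have [|z zd zi] := @exists_unity_root K d i d0; first by rewrite i0.
have /polyP/(_ i) := rotation_symmetry zd; rewrite coef_comp_scaleX => /eqP.
rewrite -subr_eq0 -{2}[f`_i]mulr1 -mulrBr mulf_eq0 subr_eq0 (negPf zi) orbF.
by move/eqP.
Qed.

End Tame.

(** The constant c is chosen so that f(X + c) has no term of degree d - 1. *)
Lemma tame_power_form (K : closedFieldType) (L : {poly K}) (Q : nat) (delta : K)
  (f psi : {poly K}) (d : nat) :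
  additive_poly L -> L`_1 != 0 -> size L = Q.+1 -> (1 < Q)%N ->
  f \Po (L + delta%:P) = psi \Po f -> size f = d.+1 -> d%:R != 0 :> K ->
  exists a c b, a != 0 /\ f = a *: ('X - c%:P) ^+ d + b%:P.
Proof.
move=> addL L1 sL Q1 semi sf d0.
have d_gt0 : (0 < d)%N by case: (d) d0 => [|//]; rewrite eqxx.
have fd : f`_d != 0.
  by rewrite -[d]/(d.+1.-1) -sf -/(lead_coef f) lead_coef_eq0 -size_poly_eq0 sf.
pose c := - (f`_d.-1 / (f`_d * d%:R)).
pose h := f \Po ('X + c%:P).
have sh : size h = d.+1 by rewrite size_comp_poly2 // size_XaddC.
have coefh i : h`_i = \sum_(j < d.+1) c ^+ j * (f`_(i + j) *+ 'C(i + j, j)).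
  rewrite /h comp_XaddC_nderivn coef_sum sf; apply: eq_bigr => j _.
  by rewrite coefZ coef_nderivn addnC.
have hd : h`_d = f`_d.
  rewrite coefh big_ord_recl /= expr0 mul1r addn0 bin0 mulr1n big1 ?addr0 // => i _.
  by rewrite nth_default ?mul0rn ?mulr0 // sf /bump /= addnS ltnS leq_addr.
have hd1 : h`_d.-1 = 0.
  rewrite coefh -(prednK d_gt0) big_ord_recl big_ord_recl /= big1 => [|i _]; last first.
    rewrite nth_default ?mul0rn ?mulr0 // sf /bump /= !add1n !addnS !ltnS.
    by rewrite -addSn prednK // leq_addr.
  rewrite addr0 expr0 mul1r addn0 bin0 mulr1n expr1 addn1 bin1 prednK //.
  by rewrite -[f`_d *+ d]mulr_natr /c mulNr divfK ?subrr // mulf_neq0.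
have semih : h \Po (L + (L.[c] + delta - c)%:P) = psi \Po h.
  rewrite /h comp_polyA -semi -!comp_polyA; congr (_ \Po _); apply: poly_ext => x.
  by rewrite !(horner_comp, hornerE) /= addL subrK.
have e := tame_monomial addL L1 sL Q1 semih sh d0 hd1.
exists f`_d, c, h`_0; split=> //.
transitivity (h \Po ('X - c%:P)).
  by rewrite /h -comp_polyA comp_polyD comp_polyX comp_polyC subrK comp_polyXr.
by rewrite {1}e hd comp_polyD comp_polyC comp_polyZ rmorphXn /= comp_polyX.
Qed.

(** * Structure of polynomial semiconjugacies *)

Section Structure.
Variables (K : closedFieldType) (p : nat).
Hypothesis pK : p \in [pchar K].

(** The quotient of the affine line by a finite additive group U of translations. *)
Section Translations.
Variable U : seq K.
Hypotheses (uU : uniq U) (U0 : 0 \in U) (UB : forall s t, s \in U -> t \in U -> t - s \in U).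

Definition quotient_poly : {poly K} := \prod_(t <- U) ('X - t%:P).
Let A := quotient_poly.

Let sA : size A = (size U).+1.
Proof. exact: size_prod_XsubC. Qed.

Let rA x : root A x = (x \in U).
Proof. exact: root_prod_XsubC. Qed.

Let UD s t : s \in U -> t \in U -> t + s \in U.
Proof.
move=> sU tU; rewrite -[s]opprK; apply: UB => //.
by rewrite -[- s]add0r; apply: UB.
Qed.

Lemma quotient_poly_period x s : s \in U -> A.[x + s] = A.[x].
Proof.
move=> sU; rewrite !horner_prod.
have pU : perm_eq U [seq t + s | t <- U].
  apply: uniq_perm => //; first by rewrite map_inj_uniq //; exact: addIr.
  move=> t; apply/idP/mapP => [tU|[t' t'U ->]]; last exact: UD.
  by exists (t - s); rewrite ?subrK //; apply: UB.
rewrite (perm_big _ pU) big_map; apply: eq_bigr => t _.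
by rewrite !hornerE opprD addrACA subrr addr0.
Qed.

(** For fixed s, A(x + s) - A(x) - A(s) has degree less than #|U| in x and vanishes on U. *)
Lemma quotient_poly_additive : additive_poly A.
Proof.
move=> x s; pose B := (A \Po ('X + s%:P)) - A - A.[s]%:P.
suff B0 : B = 0.
  have := congr1 (fun q => q.[x]) B0.
  by rewrite !(horner_comp, hornerE) -addrA -opprD => /eqP; rewrite subr_eq0 => /eqP.
have sAs : size (A \Po ('X + s%:P)) = size A by rewrite size_comp_poly2 // size_XaddC.
have sB : (size B <= size U)%N.
  apply: (leq_trans (size_polyD _ _)); rewrite geq_max size_polyN.
  apply/andP; split; last first.
    by rewrite (leq_trans (size_polyC_leq1 _)) //; case: (U) U0.
  apply/leq_sizeP => i; rewrite leq_eqVlt => /orP[/eqP <-|h].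
    have l1 : lead_coef A = 1 by apply/monicP; exact: monic_prod_XsubC.
    have l2 : lead_coef (A \Po ('X + s%:P)) = 1.
      by rewrite lead_coef_comp ?size_XaddC // lead_coefXaddC expr1n mulr1.
    move: l1 l2; rewrite !lead_coefE sAs sA coefB => -> ->.
    exact: subrr.
  by rewrite coefB !nth_default ?subr0 // ?sAs sA.
apply/eqP; apply/negPn/negP => B0.
have allB : all (root B) U.
  apply/allP => t tU; rewrite /root !(horner_comp, hornerE) [t + s]addrC.
  rewrite quotient_poly_period //; have /eqP -> : A.[t] == 0 by rewrite -/(root A t) rA.
  by rewrite subr0 subrr.
by have := max_poly_roots B0 allB uU; rewrite ltnNge sB.
Qed.

Lemma quotient_poly_sep : A`_1 != 0.
Proof.
have -> : A = 'X * \prod_(t <- rem 0 U) ('X - t%:P).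
  by rewrite /A /quotient_poly (perm_big _ (perm_to_rem U0)) big_cons subr0.
rewrite coefXM /= -horner_coef0 -/(root _ 0) root_prod_XsubC.
by rewrite mem_rem_uniq // inE eqxx.
Qed.

(** Division of h - h(0) by A leaves a quotient that is again periodic, of smaller size. *)
Lemma periodic_comp (h : {poly K}) :
  (forall t, t \in U -> h \Po ('X + t%:P) = h) -> exists h1, h = h1 \Po A.
Proof.
move: {2}(size h) (leqnn (size h)) => n; elim: n h => [|n IH] h sh hU.
  exists 0; rewrite comp_poly0; apply/eqP; by rewrite -size_poly_eq0 -leqn0.
have [c|] := leqP (size h) 1.
  by exists h; rewrite (size1_polyC c) comp_polyC.
move=> sh1; pose h0 := h - h.[0]%:P.
have h0U : all (root h0) U.
  apply/allP => t tU; rewrite /root !hornerE subr_eq0 -{2}(hU t tU).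
  by rewrite horner_comp !(hornerE, add0r).
have /dvdpP[q eq] : A %| h0.
  rewrite /A /quotient_poly; apply: uniq_roots_dvdp h0U _.
  by rewrite uniq_rootsE.
have A0 : A != 0 by rewrite -size_poly_eq0 sA.
have h00 : h0 != 0.
  by apply: contraTneq sh1 => /eqP; rewrite subr_eq0 => /eqP ->; rewrite -leqNgt size_polyC_leq1.
have q0 : q != 0 by apply: contraNneq h00 => e; rewrite eq e mul0r.
have sh0 : (size h0 <= n.+1)%N.
  apply: (leq_trans (size_polyD _ _)); rewrite geq_max sh size_polyN.
  by rewrite (leq_trans (size_polyC_leq1 _)).
have sq : (size q <= n)%N.
  move: sh0; rewrite eq size_mul // sA addnS /=.
  have : (0 < size U)%N by case: (U) U0.
  case: (size U) => // m _; rewrite addnS ltnS => hm; exact: leq_trans (leq_addr _ _) hm.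
have [|q1 eq1] := IH q sq.
  move=> t tU; apply: (mulIf A0); rewrite -eq.
  have {1}-> : A = A \Po ('X + t%:P).
    apply: poly_ext => x; rewrite horner_comp !hornerE; exact/esym/quotient_poly_period.
  by rewrite -comp_polyM -eq comp_polyB hU // comp_polyC.
exists (q1 * 'X + h.[0]%:P).
by rewrite comp_polyD comp_polyM comp_polyX comp_polyC -eq1 -eq subrK.
Qed.

End Translations.

(** The map f is the quotient by an additive kernel followed by the quotient by e-th roots of
    unity about c, and the first step semiconjugates g to an affine additive map. *)
Definition affine_cyclic_data (f g : {poly K}) : Prop :=
  exists A a c b e L' delta',
    [/\ additive_poly A, (1 < size A)%N, a != 0 & e%:R != 0 :> K] /\
    [/\ additive_poly L', L'`_1 != 0,
        f = (a *: ('X - c%:P) ^+ e + b%:P) \Po A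
      & A \Po g = (L' + delta'%:P) \Po A].

Lemma affine_cyclic_data_comp (f f1 g g1 A : {poly K}) :
  additive_poly A -> (1 < size A)%N -> f = f1 \Po A -> A \Po g = g1 \Po A ->
  affine_cyclic_data f1 g1 -> affine_cyclic_data f g.
Proof.
move=> addA sA -> eA [B [a [c [b [e [L' [d' [[addB sB a0 e0] [addL' L'1 -> eB]]]]]]]]].
exists (B \Po A), a, c, b, e, L', d'; split; split=> //.
- by move=> x y; rewrite !horner_comp addA addB.
- have := size_comp_poly B A; move: sA sB.
  by case: (size A) => [|[|m]]; case: (size B) => [|[|k]] //; case: (size _) => [|[|]].
- by rewrite comp_polyA.
- by rewrite -comp_polyA eA !comp_polyA eB.
Qed.

Lemma poly_ext_onto (A f g : {poly K}) : (1 < size A)%N -> f \Po A = g \Po A -> f = g.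
Proof.
move=> sA e; apply: poly_ext => y; have [x <-] := poly_onto y sA.
by rewrite -!horner_comp e.
Qed.

(** A polynomial with zero derivative involves only exponents divisible by p. *)
Lemma frobenius_descent (f : {poly K}) : f^`() = 0 -> exists f0, f = f0 \Po 'X^p.
Proof.
move=> df; have p_gt0 : (0 < p)%N by exact: prime_gt0 (pcharf_prime pK).
exists (\poly_(i < size f) f`_(p * i)); apply/polyP => i.
rewrite coef_comp_poly_Xn // coef_poly; case: ifP => [pi|pi].
  rewrite mulnC divnK //; case: ltnP => // h; rewrite nth_default //.
  by rewrite (leq_trans h) // leq_div.
have i0 : (0 < i)%N by case: (i) pi => //; rewrite dvdn0.
have /polyP/(_ i.-1) := df; rewrite coef_deriv coef0 prednK // -mulr_natr => /eqP.
by rewrite mulf_eq0 -(dvdn_pcharf pK) pi orbF => /eqP.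
Qed.

(** Induction on the size of f.  If f is inseparable, it factors through Frobenius; if it is
    preserved by translations, through their quotient polynomial; in both cases g descends to a
    map of the same kind.  If neither holds, f is a power map. *)
Theorem semiconjugacy_structure (f psi L : {poly K}) (delta : K) :
  (1 < size f)%N -> additive_poly L -> L`_1 != 0 -> (2 < size L)%N ->
  f \Po (L + delta%:P) = psi \Po f ->
  affine_cyclic_data f (L + delta%:P).
Proof.
move: {2}(size f) (leqnn (size f)) => n.
elim: n f L delta => [|n IH] f L delta; first by rewrite leqn0 => /eqP ->.
move=> sf sf1 addL L1 sL semi; set g := L + delta%:P.
have p_gt0 : (0 < p)%N by exact: prime_gt0 (pcharf_prime pK).
have p_gt1 : (1 < p)%N by exact: prime_gt1 (pcharf_prime pK).
have smaller (A f1 : {poly K}) : (2 < size A)%N -> f = f1 \Po A -> (1 < size f1 <= n)%N.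
  move=> sA ef; have e : (size f).-1 = ((size f1).-1 * (size A).-1)%N.
    by rewrite -size_comp_poly -ef.
  have d0 : (0 < (size f).-1)%N by case: (size f) sf1 => [|[|]].
  have d1 : (0 < (size f1).-1)%N by move: d0; rewrite e muln_gt0 => /andP[].
  have dA : (1 < (size A).-1)%N by case: (size A) sA => [|[|[|]]].
  have lt : ((size f1).-1 < (size f).-1)%N by rewrite e ltn_Pmulr.
  move: d1 lt sf; case: (size f1) => [|[|m]] //= _; case: (size f) => // l /= lt.
  by rewrite ltnS; apply: leq_trans.
have [df|df] := eqVneq f^`() 0.
  have [f0 ef] := frobenius_descent df.
  have sX : (2 < size ('X^p : {poly K}))%N by rewrite size_polyXn ltnS.
  have sX1 := ltnW sX.
  have /andP[sf0 sfn] := smaller _ _ sX ef.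
  pose Fr := pFrobenius_aut pK; pose LF := map_poly Fr L.
  have LFE x : LF.[x ^+ p] = L.[x] ^+ p.
    by rewrite -!(pFrobenius_autE pK) horner_map.
  have addLF : additive_poly LF.
    move=> x y; have [u] := poly_onto x sX1; have [v] := poly_onto y sX1.
    rewrite !hornerE => <- <-.
    by rewrite -!(pFrobenius_autE pK) -rmorphD /= !pFrobenius_autE !LFE addL -!(pFrobenius_autE pK) rmorphD.
  have eg : 'X^p \Po g = (LF + (delta ^+ p)%:P) \Po 'X^p.
    apply: poly_ext => x; rewrite !(horner_comp, hornerE) LFE.
    by rewrite -!(pFrobenius_autE pK) rmorphD.
  apply: (affine_cyclic_data_comp _ sX1 ef eg).
    by move=> x y; rewrite !hornerE -!(pFrobenius_autE pK) rmorphD.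
  apply: (IH f0) => //.
  - by rewrite coef_map /= fmorph_eq0.
  - by rewrite size_map_poly.
  apply: (poly_ext_onto sX1).
  by rewrite -comp_polyA -eg comp_polyA -ef semi ef comp_polyA.
have [[t0 [t00 t0f]]|notrans] := pselect (exists t, t != 0 /\ f \Po ('X + t%:P) = f).
  have f0 : f - f.[0]%:P != 0.
    by apply: contraTneq sf1 => /eqP; rewrite subr_eq0 => /eqP ->; rewrite -leqNgt size_polyC_leq1.
  have [rs ers] := closed_field_poly_normal (f - f.[0]%:P).
  pose U := [seq t <- undup rs | f \Po ('X + t%:P) == f].
  have memU t : (t \in U) = (f \Po ('X + t%:P) == f).
    rewrite mem_filter mem_undup andb_idr // => /eqP ft.
    rewrite -root_prod_XsubC -(rootZ _ _ (_ : lead_coef (f - f.[0]%:P) != 0)) ?lead_coef_eq0 //.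
    rewrite -ers /root !hornerE -{2}ft horner_comp !(hornerE, add0r) subrr //.
  have uU : uniq U by rewrite filter_uniq // undup_uniq.
  have U0 : 0 \in U by rewrite memU addr0 comp_polyXr.
  have fU t x : t \in U -> f.[x + t] = f.[x].
    by rewrite memU => /eqP ft; rewrite -{2}ft horner_comp !hornerE.
  have UP t : (forall x, f.[x + t] = f.[x]) -> t \in U.
    by move=> h; rewrite memU; apply/eqP/poly_ext => x; rewrite horner_comp !hornerE.
  have UB s t : s \in U -> t \in U -> t - s \in U.
    move=> sU tU; apply: UP => x.
    by rewrite -[LHS](fU s) // -addrA subrK fU.
  pose A := quotient_poly U.
  have addA : additive_poly A by exact: quotient_poly_additive.
  have sA : (2 < size A)%N.
    rewrite size_prod_XsubC ltnS.
    have : {subset [:: 0; t0] <= U}.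
      by move=> x; rewrite !inE => /orP[]/eqP -> //; rewrite memU t0f.
    by move/(uniq_leq_size _); apply; rewrite /= inE eq_sym t00.
  have sA1 := ltnW sA.
  have [|f1 ef] := @periodic_comp U uU U0 UB f.
    by move=> t; rewrite memU => /eqP.
  have LU t : t \in U -> L.[t] \in U.
    move=> tU; apply: UP => x.
    have sg : (1 < size g)%N.
      by rewrite (@size_g _ _ (size L).-1) ?prednK //; case: (size L) sL => [|[|[|]]].
    have [y <-] := poly_onto x sg.
    have -> : g.[y] + L.[t] = g.[y + t] by rewrite !hornerE addL addrAC.
    by rewrite -!horner_comp semi !horner_comp fU.
  have [|L0 eL] := @periodic_comp U uU U0 UB (A \Po L).
    move=> t tU; apply: poly_ext => x; rewrite !(horner_comp, hornerE) addL.
    by rewrite quotient_poly_period // LU.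
  have L0E x : L0.[A.[x]] = A.[L.[x]] by rewrite -!horner_comp eL.
  have eg : A \Po g = (L0 + (A.[delta])%:P) \Po A.
    by apply: poly_ext => x; rewrite !(horner_comp, hornerE) addA L0E.
  have /andP[sf0 sfn] := smaller _ _ sA ef.
  apply: (affine_cyclic_data_comp addA sA1 ef eg).
  apply: (IH f1) => //.
  - move=> x y; have [u <-] := poly_onto x sA1; have [v <-] := poly_onto y sA1.
    by rewrite -addA !L0E addL addA.
  - have A1 : A`_1 != 0 by exact: quotient_poly_sep.
    have := congr1 (fun q => (q^`()).[0]) eL.
    rewrite !deriv_comp !hornerM !horner_comp (additive_poly0 addA) (additive_poly0 addL).
    rewrite !horner_coef0 !coef_deriv !mulr1n => e0.
    by apply: contraNneq (mulf_neq0 A1 L1) => L00; rewrite e0 L00 mul0r.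
  - have := congr1 (fun q : {poly K} => (size q).-1) eL; rewrite /= !size_comp_poly mulnC => /eqP.
    rewrite eqn_pmul2r; last by case: (size A) sA => [|[|]].
    by move=> /eqP e; case: (size L0) e sL => [|m] /=; case: (size L) => [|[|[|]]] //= k <-.
  apply: (poly_ext_onto sA1).
  by rewrite -comp_polyA -eg comp_polyA -ef semi ef comp_polyA.
have nt t : f \Po ('X + t%:P) = f -> t = 0.
  by move=> h; apply/eqP; apply/negPn/negP => t0; apply: notrans; exists t.
have sLQ : size L = (size L).-1.+1 by rewrite prednK // (leq_trans _ sL).
have Q1 : (1 < (size L).-1)%N by case: (size L) sL => [|[|[|]]].
have dp := deg_coprime addL L1 sLQ Q1 semi df nt pK.
have sfd : size f = (size f).-1.+1 by rewrite prednK // ltnW.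
have dK : (size f).-1%:R != 0 :> K by rewrite -(dvdn_pcharf pK).
have [a [c [b [a0 ef]]]] := tame_power_form addL L1 sLQ Q1 semi sfd dK.
exists 'X, a, c, b, (size f).-1, L, delta; split; split=> //.
- by move=> x y; rewrite !hornerE.
- by rewrite size_polyX.
- by rewrite comp_polyXr.
- by rewrite comp_polyX comp_polyXr.
Qed.

End Structure.

(** * Iterated preimages under affine additive maps *)

Section EventuallyPeriodic.
Variables (T : eqType) (F : T -> T).

Definition eventually_periodic i P x := iter (i + P) F x = iter i F x.

Lemma eventually_periodic_finite x (s : seq T) : (forall n, iter n F x \in s) ->
  exists i P, (0 < P)%N /\ eventually_periodic i P x.
Proof.
move=> xs; pose t := [seq iter n F x | n <- iota 0 (size s).+1].
have nu : ~~ uniq t.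
  apply/negP => ut; have : (size t <= size s)%N.
    by apply: uniq_leq_size => // _ /mapP[n _ ->].
  by rewrite size_map size_iota ltnn.
have [i [k [ik kt e]]] : exists i k, [/\ (i < k)%N, (k < size t)%N & iter i F x = iter k F x].
  have /(uniqPn x)[i [k [ik kt e]]] := nu; exists i, k; split=> //.
  move: e; rewrite !(nth_map 0%N) ?size_iota ?nth_iota //;
    rewrite ?size_map ?size_iota in kt *; rewrite ?(ltn_trans ik kt) //.
by exists i, (k - i)%N; rewrite subn_gt0 ik /eventually_periodic subnKC // ltnW.
Qed.

Lemma eventually_periodic_mul i P m x :
  eventually_periodic i P x -> eventually_periodic i (m * P) x.
Proof.
rewrite /eventually_periodic => h; elim: m => [|m IH]; first by rewrite addn0.
by rewrite mulSn addnA [(_ + m * P)%N]addnC iterD h -iterD addnC IH.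
Qed.

Lemma eventually_periodic_add i k P x :
  eventually_periodic i P x -> eventually_periodic (k + i) P x.
Proof. by rewrite /eventually_periodic => h; rewrite -addnA iterD h -iterD. Qed.

(** Uniform over a finite set: take the sum of the preperiods and the product of the periods. *)
Lemma eventually_periodic_seq (s : seq T) :
  (forall x, x \in s -> exists i P, (0 < P)%N /\ eventually_periodic i P x) ->
  exists i P, (0 < P)%N /\ forall x, x \in s -> eventually_periodic i P x.
Proof.
elim: s => [|x s IH] h; first by exists 0%N, 1%N.
have [|i [P [P0 hs]]] := IH; first by move=> y ys; apply: h; rewrite inE ys orbT.
have [|k [R [R0 hx]]] := h x; first by rewrite inE eqxx.
exists (k + i)%N, (P * R)%N; split=> [|y]; first by rewrite muln_gt0 P0.
rewrite inE => /orP[/eqP ->|ys].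
  by rewrite addnC; apply/eventually_periodic_add/eventually_periodic_mul.
by rewrite mulnC; apply/eventually_periodic_add/eventually_periodic_mul/hs.
Qed.

End EventuallyPeriodic.

Section Iterates.
Variable K : closedFieldType.
Implicit Types (g L : {poly K}).

Definition backward (g : {poly K}) (a : K) : set K :=
  [set x | exists n, iter n (horner g) x = a]%classic.

Lemma iter_onto g n y : (1 < size g)%N -> exists x, iter n (horner g) x = y.
Proof.
move=> sg; elim: n y => [|n IH] y; first by exists y.
by have [z <-] := poly_onto y sg; have [x <-] := IH z; exists x.
Qed.

Lemma iter_additive L n x y : additive_poly L ->
  iter n (horner L) (x + y) = iter n (horner L) x + iter n (horner L) y.
Proof. by move=> addL; elim: n => //= n ->; exact: addL. Qed.

Lemma iter_additive0 L n : additive_poly L -> iter n (horner L) 0 = 0.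
Proof. by move=> addL; elim: n => //= n ->; exact: additive_poly0. Qed.

Lemma iter_additiveN L n x : additive_poly L ->
  iter n (horner L) (- x) = - iter n (horner L) x.
Proof. by move=> addL; elim: n => //= n ->; exact: additive_polyN. Qed.

Lemma iter_additiveB L n x y : additive_poly L ->
  iter n (horner L) (x - y) = iter n (horner L) x - iter n (horner L) y.
Proof. by move=> addL; rewrite iter_additive // iter_additiveN. Qed.

Lemma iter_affine L d n x y : additive_poly L ->
  iter n (horner (L + d%:P)) (x + y) = iter n (horner (L + d%:P)) x + iter n (horner L) y.
Proof. by move=> addL; elim: n => //= n ->; rewrite !hornerE addL addrAC. Qed.

(** Translation by the fixed point w of L + d conjugates L + d0 to L + d0 + d. *)
Lemma iter_translate L d0 d w n x : additive_poly L -> L.[w] + d = w ->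
  iter n (horner (L + (d0 + d)%:P)) (x + w) = iter n (horner (L + d0%:P)) x + w.
Proof.
move=> addL hw; elim: n => //= n ->; rewrite !hornerD !hornerC addL.
by rewrite addrACA hw.
Qed.

End Iterates.

Section Commutation.
Variable K : closedFieldType.
Variables s t : {rmorphism K -> K}.

Definition commute_at x := s (t x) = t (s x).

Lemma commute_at_fixed x : s x = x -> t x = x -> commute_at x.
Proof. by rewrite /commute_at => sx tx; rewrite tx !sx tx. Qed.

Lemma commute_atD x y : commute_at x -> commute_at y -> commute_at (x + y).
Proof. by rewrite /commute_at !rmorphD => -> ->. Qed.

Lemma commute_atB x y : commute_at x -> commute_at y -> commute_at (x - y).
Proof. by rewrite /commute_at !rmorphB => -> ->. Qed.

Lemma commute_at_horner (p : {poly K}) x :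
  map_poly s p = p -> map_poly t p = p -> commute_at x -> commute_at p.[x].
Proof.
have h (r : {rmorphism K -> K}) y : map_poly r p = p -> r p.[y] = p.[r y].
  by move=> e; rewrite -horner_map e.
by move=> sp tp; rewrite /commute_at !h // => ->.
Qed.

End Commutation.

Lemma fixed_horner (K : closedFieldType) (s : {rmorphism K -> K}) (p : {poly K}) x :
  map_poly s p = p -> s p.[x] = p.[s x].
Proof. by move=> e; rewrite -horner_map e. Qed.

Lemma fixed_iter (K : closedFieldType) (s : {rmorphism K -> K}) (p : {poly K}) n x :
  map_poly s p = p -> s (iter n (horner p) x) = iter n (horner p) (s x).
Proof. by move=> e; elim: n => //= n <-; rewrite fixed_horner. Qed.

Section Arithmetic.
Variables (E : fieldType) (K : closedFieldType) (j : {rmorphism E -> K}).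
Hypothesis algE : forall x : K, exists2 q : {poly E}, q != 0 & root (map_poly j q) x.
Variable p : nat.
Hypothesis pK : p \in [pchar K].

(** Being fixed by Aut(K/E) replaces being defined over E, from which it differs by a purely
    inseparable extension. *)
Definition fixed_poly (f : {poly K}) :=
  forall s : {rmorphism K -> K}, fixes j s -> map_poly s f = f.

Definition fixed_point (a : K) :=
  forall s : {rmorphism K -> K}, fixes j s -> s a = a.

Lemma backward_stable g a : fixed_poly g -> fixed_point a -> aut_stable j (backward g a).
Proof.
move=> fg fa s fs x [n e]; exists n.
by rewrite -fixed_iter ?fg // e fa.
Qed.

Variables (L : {poly K}) (alpha : K).
Hypotheses (addL : additive_poly L) (sL : (2 < size L)%N) (fL : fixed_poly L).
Hypothesis falpha : fixed_point alpha.

Lemma size_affine d : size (L + d%:P) = size L.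
Proof.
by rewrite size_polyDl // (leq_ltn_trans (size_polyC_leq1 _)) // ltnW.
Qed.

Let sL1 : (1 < size L)%N. Proof. exact: ltnW. Qed.

(** The group ker L^n acts on the preimages of alpha at level n by translation. *)
Lemma torsion_difference d n v : iter n (horner L) v = 0 ->
  exists2 s, backward (L + d%:P) alpha s & backward (L + d%:P) alpha (s + v).
Proof.
move=> hv; have [|s es] := @iter_onto K (L + d%:P) n alpha; first by rewrite size_affine.
by exists s; exists n => //; rewrite iter_affine // hv addr0.
Qed.

(** From L(w) = w - d it follows that u = L^(i+P)(w) - L^i(w) is fixed by L; iterating p times
    adds p u = 0, so p P is a period. *)
Lemma affine_translation_preperiodic d w :
  (exists i P, (0 < P)%N /\ eventually_periodic (horner L) i P d) ->
  L.[w] + d = w ->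
  exists i P, (0 < P)%N /\ eventually_periodic (horner L) i P w.
Proof.
move=> [i [P [P0 hd]]] hw.
pose u := iter (i + P) (horner L) w - iter i (horner L) w.
have Lw : L.[w] = w - d by rewrite -{2}hw addrK.
have Lu : L.[u] = u.
  have e n : L.[iter n (horner L) w] = iter n (horner L) w - iter n (horner L) d.
    by rewrite -iterS iterSr Lw iter_additiveB.
  by rewrite /u additive_polyB // !e hd opprB addrA subrK.
have Lnu n : iter n (horner L) u = u by elim: n => //= n ->.
have eP : iter (i + P) (horner L) w = iter i (horner L) w + u by rewrite addrC subrK.
have key m : iter (i + m * P) (horner L) w = iter i (horner L) w + u *+ m.
  elim: m => [|m IH]; first by rewrite addn0 addr0.
  rewrite mulSn addnA [(_ + m * P)%N]addnC iterD eP iter_additive // Lnu -iterD addnC IH.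
  by rewrite -addrA -mulrSr.
exists i, (p * P)%N; split.
  by rewrite muln_gt0 P0 prime_gt0 // (pcharf_prime pK).
by rewrite /eventually_periodic key mulrn_pchar // addr0.
Qed.

(** Each preimage x of alpha under L + d0 + d is written as an integral combination of preimages
    under L + d0 and of iterates of w, which are fixed once w is. *)
Lemma backward_translate d0 d :
  (exists i P, (0 < P)%N /\ eventually_periodic (horner L) i P d) ->
  virtually_commuting j (backward (L + d0%:P) alpha) ->
  virtually_commuting j (backward (L + (d0 + d)%:P) alpha).
Proof.
move=> hd [W hW].
have [w hw] : exists w, L.[w] + d = w.
  pose LX := L - 'X + d%:P.
  have sLX : (1 < size LX)%N.
    have sX : size (L - 'X) = size L by rewrite size_polyDl // size_polyN size_polyX.
    by rewrite /LX size_polyDl sX // (leq_ltn_trans (size_polyC_leq1 _)).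
  have [w] := poly_onto 0 sLX; rewrite !hornerE => e; exists w.
  by apply/eqP; rewrite -subr_eq0 addrAC e.
have [i [P [P0 per]]] := affine_translation_preperiodic hd hw.
exists (w :: W) => s t fs ft hs ht x [n xn].
have cS0 y : backward (L + d0%:P) alpha y -> commute_at s t y.
  by apply: hW => // z zW; [apply: hs | apply: ht]; rewrite inE zW orbT.
have [sw tw] : s w = w /\ t w = w by split; [apply: hs | apply: ht]; rewrite inE eqxx.
have cw k : commute_at s t (iter k (horner L) w).
  by apply: commute_at_fixed; rewrite fixed_iter ?fL // ?sw ?tw.
(* The orbit of w is eventually periodic, so w differs from a point of L^n(orbit of w) by
   the torsion point w2; both parts can then be divided by L^n. *)
have nP : (n <= n * P)%N by rewrite leq_pmulr.
pose w1 := iter (n * P - n) (horner L) w; pose w2 := w - iter (n * P) (horner L) w.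
have ew : w = iter n (horner L) w1 + w2 by rewrite /w1 -iterD subnKC // /w2 addrC subrK.
have tor2 : iter i (horner L) w2 = 0.
  by rewrite /w2 iter_additiveB // -iterD (eventually_periodic_mul n per) subrr.
have [v ev] := iter_onto n w2 sL1.
have [|s1 Ss1 Ss1v] := @torsion_difference d0 (i + n) v; first by rewrite iterD ev.
have Sz : backward (L + d0%:P) alpha (x - w + w1 + v).
  have xw : iter n (horner (L + d0%:P)) (x - w) = alpha - w.
    by rewrite -xn -[in RHS](subrK w x) iter_translate // addrK.
  by exists n; rewrite (iter_affine d0 n _ v addL) (iter_affine d0 n _ w1 addL) ev xw -addrA -ew subrK.
have -> : x = (x - w + w1 + v) - (s1 + v - s1) - w1 + w.
  by rewrite [s1 + v]addrC addrK !addrK subrK.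
apply: commute_atD; last exact: (cw 0%N).
apply: commute_atB; last exact: cw.
by do ![apply: commute_atB | exact: cS0].
Qed.

End Arithmetic.

(** * Iterated preimages under a semiconjugate map *)

Lemma poly_roots_seq (K : closedFieldType) (q : {poly K}) : q != 0 ->
  exists rs : seq K, forall x, (x \in rs) = root q x.
Proof.
move=> q0; have [rs ers] := closed_field_poly_normal q; exists rs => x.
by rewrite ers rootZ ?root_prod_XsubC // lead_coef_eq0.
Qed.

Lemma expr_eq_ratio (K : fieldType) (e : nat) (x y : K) : (0 < e)%N ->
  x ^+ e = y ^+ e -> exists2 z, z ^+ e = 1 & x = z * y.
Proof.
move=> e0 h; have [y0|y0] := eqVneq y 0.
  exists 1; rewrite ?expr1n // mul1r y0; apply/eqP.
  by move/eqP: h; rewrite y0 expr0n gtn_eqF // expf_eq0 e0.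
exists (x / y); last by rewrite divfK.
by rewrite expr_div_n h mulfV // expf_neq0.
Qed.

Lemma map_poly_fixed (K : closedFieldType) (s : {rmorphism K -> K}) (q : {poly K}) :
  {in (q : seq K), s =1 id} -> map_poly s q = q.
Proof.
move=> h; apply/polyP => i; rewrite coef_map /=.
have [lt|ge] := ltnP i (size q); first by rewrite h // mem_nth.
by rewrite nth_default ?rmorph0.
Qed.

(** In the coordinate w = A - c, the map g becomes h and the fibres of f become the orbits of the
    e-th roots of unity. *)
Section CyclicSemiconjugacy.
Variables (E : fieldType) (K : closedFieldType) (j : {rmorphism E -> K}).
Hypothesis algE : forall x : K, exists2 q : {poly E}, q != 0 & root (map_poly j q) x.
Variables (L f psi : {poly K}) (alpha delta : K).
Hypotheses (addL : additive_poly L) (sL : (2 < size L)%N).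
Let g := L + delta%:P.
Hypotheses (fg : fixed_poly j g) (ff : fixed_poly j f) (falpha : fixed_point j alpha).
Hypothesis semi : f \Po g = psi \Po f.
Variables (A : {poly K}) (a c b : K) (e : nat) (L' : {poly K}) (delta' : K).
Hypotheses (addA : additive_poly A) (sA : (1 < size A)%N) (a0 : a != 0) (e0 : e%:R != 0 :> K).
Hypotheses (addL' : additive_poly L') (L'1 : L'`_1 != 0).
Hypothesis ef : f = (a *: ('X - c%:P) ^+ e + b%:P) \Po A.
Hypothesis eA : A \Po g = (L' + delta'%:P) \Po A.

Let e_gt0 : (0 < e)%N.
Proof. by case: (e) e0 => [|//]; rewrite eqxx. Qed.

Let w := A - c%:P.
Let h := L' + (L'.[c] + delta' - c)%:P.

Let wE x : w.[x] = A.[x] - c. Proof. by rewrite !hornerE. Qed.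

Let fE x : f.[x] = a * w.[x] ^+ e + b.
Proof. by rewrite ef wE !(horner_comp, hornerE). Qed.

Let f_fiber x y : f.[x] = f.[y] <-> w.[x] ^+ e = w.[y] ^+ e.
Proof.
rewrite !fE; split=> [|->//]; rewrite -![_ + b]addrC => /addrI.
exact: mulfI.
Qed.

Let sw : (1 < size w)%N.
Proof.
by rewrite size_polyDl // size_polyN (leq_ltn_trans (size_polyC_leq1 _)).
Qed.

Let AgE x : A.[g.[x]] = L'.[A.[x]] + delta'.
Proof. by rewrite -horner_comp eA horner_comp hornerD hornerC. Qed.

Let wg x : w.[g.[x]] = h.[w.[x]].
Proof.
rewrite !wE AgE /h hornerD hornerC additive_polyB //.
by rewrite addrA addrA subrK.
Qed.

Let wgn n x : w.[iter n (horner g) x] = iter n (horner h) w.[x].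
Proof. by elim: n => //= n <-; rewrite wg. Qed.

Let fgn n x : f.[iter n (horner g) x] = iter n (horner psi) f.[x].
Proof. by elim: n => //= n <-; rewrite -!horner_comp semi. Qed.

Let h_neq0 : h != 0.
Proof.
apply: contraNneq L'1 => h0; have := congr1 (coefp 1) h0.
by rewrite /= /h coefD coefC addr0 coef0 => ->.
Qed.

(** Since h(zy)^e = h(y)^e, there is an e-th root of unity x with h(zX) = x h; the linear
    coefficient of h, which is nonzero, shows that x = z. *)
Let h_equivariant z y : z ^+ e = 1 -> h.[z * y] = z * h.[y].
Proof.
move=> ze; have [rs ers] : exists rs : seq K, forall x, (x \in rs) = (x ^+ e == 1).
  have [|rs ers] := @poly_roots_seq K ('X^e - 1%:P).
    by rewrite -size_poly_eq0 size_XnsubC.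
  by exists rs => x; rewrite ers /root !hornerE subr_eq0.
have prod0 : \prod_(x <- rs) ((h \Po (z *: 'X)) - x *: h) = 0.
  apply: poly_ext => x; rewrite horner0 horner_prod.
  have [u eu] := poly_onto x sw; have [v ev] := poly_onto (z * x) sw.
  have /f_fiber fuv : w.[v] ^+ e = w.[u] ^+ e by rewrite ev eu exprMn ze mul1r.
  have /f_fiber : f.[g.[v]] = f.[g.[u]] by rewrite -!horner_comp semi !horner_comp fuv.
  rewrite !wg ev eu => /(expr_eq_ratio e_gt0)[y0 /eqP y0e eh].
  apply/eqP; rewrite prodf_seq_eq0; apply/hasP; exists y0; first by rewrite ers.
  by rewrite /= hornerD hornerN horner_comp !hornerZ hornerX eh subrr.
move/eqP: prod0; rewrite prodf_seq_eq0 => /hasP[x _ /=]; rewrite subr_eq0 => /eqP eh.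
have xz : x = z.
  have := congr1 (coefp 1) eh; rewrite /= coefZ.
  have -> : h`_1 = L'`_1 by rewrite coefD coefC addr0.
  have -> : (h \Po (z *: 'X))`_1 = L'`_1 * z.
    rewrite /h comp_polyD comp_polyC coefD coefC addr0.
    have -> : L' \Po (z *: 'X) = \poly_(i < size L') (L'`_i * z ^+ i).
      rewrite comp_polyE poly_def; apply: eq_bigr => i _.
      by rewrite exprZn scalerA.
    rewrite coef_poly expr1; case: ltnP => // le.
    by rewrite nth_default ?mul0r.
  by rewrite mulrC => /(mulIf L'1).
by have := congr1 (horner^~ y) eh; rewrite /= xz horner_comp !hornerZ hornerX.
Qed.

Let hn_equivariant n z y : z ^+ e = 1 ->
  iter n (horner h) (z * y) = z * iter n (horner h) y.
Proof. by move=> ze; elim: n => //= n ->; apply: h_equivariant. Qed.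

Let A_neq0 : A != 0. Proof. by rewrite -size_poly_gt0 ltnW. Qed.

(** The kernel of A is finite and stable under L, because A o g factors through A. *)
Let kerL k : root A k -> root A L.[k].
Proof.
move=> /rootP Ak; apply/rootP; have := AgE k.
have -> : g.[k] = g.[0] + L.[k].
  by rewrite /g !hornerD !hornerC (additive_poly0 addL) add0r addrC.
rewrite addA AgE Ak -[L'.[_]](addrK L'.[A.[0]]).
rewrite (additive_poly0 addA) => /eqP; rewrite addrK.
by rewrite -{2}[_ + delta']addr0 => /eqP /addrI.
Qed.

Let kerLn n k : root A k -> root A (iter n (horner L) k).
Proof. by move=> Ak; elim: n => //= n; exact: kerL. Qed.

Let ker_periodic : exists i P, (0 < P)%N /\
  forall k, root A k -> eventually_periodic (horner L) i P k.
Proof.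
have [rs ers] := poly_roots_seq A_neq0.
have [|i [P [P0 hP]]] := @eventually_periodic_seq K (horner L) rs.
  move=> k; rewrite ers => Ak; apply: (@eventually_periodic_finite _ _ _ rs) => n.
  by rewrite ers kerLn.
by exists i, P; split=> // k Ak; apply: hP; rewrite ers.
Qed.

(** A point of the backward orbit of f(alpha) is f(x) with w(g^n(x)) = z w(alpha), z^e = 1.
    Rotating w(x) by z^-1 makes g^n(x) - alpha an element k of ker A.  Up to torsion, k is
    L^n(k1) with k1 in ker A, and replacing x by x - k1 does not change f(x). *)
Lemma virtually_commuting_push :
  virtually_commuting j (backward g alpha) ->
  virtually_commuting j (backward psi f.[alpha]).
Proof.
move=> [W hW]; exists W => s t fs ft hs ht y [n yn].
have cS x : backward g alpha x -> commute_at s t x by apply: hW.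
have sf : (1 < size f)%N.
  have sq : size (a *: ('X - c%:P) ^+ e + b%:P) = e.+1.
    have se : size (a *: ('X - c%:P) ^+ e) = e.+1 by rewrite size_scale // size_exp_XsubC.
    by rewrite size_polyDl se // (leq_ltn_trans (size_polyC_leq1 _)).
  have := size_comp_poly (a *: ('X - c%:P) ^+ e + b%:P) A; rewrite -ef sq /=.
  by case: (size f) => [|[|//]] /= /esym/eqP; rewrite muln_eq0 gtn_eqF //=;
    case: (size A) sA => [|[|]].
have [x ex] := poly_onto y sf.
have : f.[iter n (horner g) x] = f.[alpha] by rewrite fgn ex.
move/f_fiber => /(expr_eq_ratio e_gt0)[z ze]; rewrite wgn => wx.
have z0 : z != 0.
  by apply/eqP => z0; move/eqP: ze; rewrite z0 expr0n gtn_eqF // eq_sym oner_eq0.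
have [x1 ex1] := poly_onto (z^-1 * w.[x]) sw.
have zVe : z^-1 ^+ e = 1 by rewrite exprVn ze invr1.
have fx1 : f.[x1] = y.
  by rewrite -ex; apply/f_fiber; rewrite ex1 exprMn zVe mul1r.
have wx1 : w.[iter n (horner g) x1] = w.[alpha].
  by rewrite wgn ex1 hn_equivariant // wx mulKf.
pose k := iter n (horner g) x1 - alpha.
have Ak : root A k.
  apply/rootP; rewrite /k additive_polyB //; apply/eqP; rewrite subr_eq0; apply/eqP.
  by move: wx1; rewrite !wE => /addIr.
have [i [P [P0 per]]] := ker_periodic.
have nP : (n <= n * P)%N by rewrite leq_pmulr.
pose k1 := iter (n * P - n) (horner L) k; pose k2 := k - iter (n * P) (horner L) k.
have ek : k = iter n (horner L) k1 + k2 by rewrite /k1 -iterD subnKC // /k2 addrC subrK.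
have tor2 : iter i (horner L) k2 = 0.
  by rewrite /k2 iter_additiveB // -iterD (eventually_periodic_mul n (per k Ak)) subrr.
have Ak1 : root A k1 by exact: kerLn.
have [v ev] := iter_onto n k2 (ltnW sL).
have [|s1 Ss1 Ss1v] := @torsion_difference K L alpha addL sL delta (i + n) v.
  by rewrite iterD ev.
pose x2 := x1 - k1.
have fx2 : f.[x2] = y.
  rewrite -fx1; apply/f_fiber; congr (_ ^+ _).
  by rewrite !wE /x2 additive_polyB // (rootP Ak1) subr0.
have Sx2 : backward g alpha (x2 - v).
  exists n; rewrite /x2 /g (iter_affine delta n _ (- v) addL) (iter_affine delta n _ (- k1) addL).
  rewrite !iter_additiveN // ev -addrA -opprD -ek /k opprB addrC subrK //.
have cx2 : commute_at s t x2.
  have -> : x2 = (x2 - v) + (s1 + v - s1) by rewrite [s1 + v]addrC addrK subrK.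
  by apply: commute_atD; [|apply: commute_atB]; exact: cS.
by rewrite -fx2; apply: commute_at_horner; rewrite ?ff.
Qed.

(** The enlarged W contains the coefficients of w and h, the kernel of A and the zeros of h. *)
Lemma virtually_commuting_lift :
  virtually_commuting j (backward psi f.[alpha]) ->
  virtually_commuting j (backward g alpha).
Proof.
move=> [W hW].
have [rsA ersA] := poly_roots_seq A_neq0.
have [rsh ersh] := poly_roots_seq h_neq0.
exists (W ++ (w : seq K) ++ (h : seq K) ++ rsA ++ rsh) => s t fs ft hs ht x0 Sx0.
(* It suffices that the commutator ga of s and t is trivial on the preimages of alpha: it
   fixes their images under f, and everything that s and t fix. *)
have fst : fixes j (s \o t) by move=> y /=; rewrite ft fs.
have fts : fixes j (t \o s) by move=> y /=; rewrite fs ft.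
have [v fv [vK Kv]] := inverse_aut algE fts.
pose ga : {rmorphism K -> K} := v \o (s \o t).
have fga : fixes j ga by move=> y /=; rewrite ft fs fv.
suff gaS : forall x, backward g alpha x -> ga x = x.
  by rewrite -[LHS](Kv (s (t x0))) -[v _]/(ga x0) gaS.
have ga_fix y : s y = y -> t y = y -> ga y = y.
  by move=> sy ty; rewrite /= ty sy; have := vK y; rewrite /= sy ty.
have ga_in y : y \in W ++ (w : seq K) ++ (h : seq K) ++ rsA ++ rsh -> ga y = y.
  by move=> yW; apply: ga_fix; [exact: hs | exact: ht].
have gw : map_poly ga w = w.
  by apply: map_poly_fixed => y yw; apply: ga_in; rewrite !mem_cat yw orbT.
have gh : map_poly ga h = h.
  by apply: map_poly_fixed => y yh; apply: ga_in; rewrite !mem_cat yh !orbT.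
have gA y : root A y -> ga y = y.
  by move=> Ay; apply: ga_in; rewrite !mem_cat ersA Ay !orbT.
have ghr y : root h y -> ga y = y.
  by move=> hy; apply: ga_in; rewrite !mem_cat ersh hy !orbT.
have gg : map_poly ga g = g by exact: fg.
have gal : ga alpha = alpha by exact: falpha.
have gf x : backward g alpha x -> ga f.[x] = f.[x].
  move=> [n xn]; have Sf : backward psi f.[alpha] f.[x] by exists n; rewrite -fgn xn.
  rewrite /= (hW s t fs ft _ _ _ Sf) => [|y yW|y yW]; last first.
  - by apply: ht; rewrite mem_cat yW.
  - by apply: hs; rewrite mem_cat yW.
  - exact: (vK f.[x]).
(* ga multiplies w(x) by an e-th root of unity z; as h is equivariant and ga fixes h(w(x)) by
   induction, z = 1 unless h(w(x)) = 0, and then w(x) is among the constants. *)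
have wfix n x : iter n (horner g) x = alpha -> ga w.[x] = w.[x].
  elim: n x => [|n IH] x; first by move=> xa; have -> : x = alpha by []; rewrite (fixed_horner _ gw) gal.
  rewrite iterSr => xn; have := IH _ xn; rewrite wg => hw.
  have Sx : backward g alpha x by exists n.+1; rewrite iterSr.
  have /f_fiber : f.[ga x] = f.[x] by rewrite -(fixed_horner _ (ff fga)) gf.
  rewrite -(fixed_horner _ gw) => /(expr_eq_ratio e_gt0)[z ze ez].
  have [h0|h0] := eqVneq h.[w.[x]] 0; first by apply: ghr; apply/rootP.
  have : z * h.[w.[x]] = h.[w.[x]].
    by rewrite -h_equivariant // -ez -(fixed_horner _ gh) hw.
  by rewrite -{2}[h.[_]]mul1r => /(mulIf h0) z1; rewrite ez z1 mul1r.
have kA x : backward g alpha x -> root A (ga x - x).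
  move=> [n xn]; apply/rootP; rewrite additive_polyB //.
  have := wfix n x xn; rewrite (fixed_horner _ gw) !wE => /addIr ->.
  exact: subrr.
have kn n x : iter n (horner L) (ga x - x) = ga (iter n (horner g) x) - iter n (horner g) x.
  rewrite (fixed_iter _ _ gg).
  have -> : iter n (horner g) (ga x) = iter n (horner g) x + iter n (horner L) (ga x - x).
    by rewrite -(iter_affine delta n _ _ addL) [x + _]addrC subrK.
  by rewrite [in RHS]addrC addKr.
move=> x [n xn]; have [i [P [P0 per]]] := ker_periodic.
(* ga x - x is L^i of an element of ker A, hence periodic, and is killed by L^n. *)
have [|y ey] := @iter_onto K g i x; first by rewrite size_affine // ltnW.
have Sy : backward g alpha y by exists (n + i)%N; rewrite iterD ey.
have nP : (n <= n * P)%N by rewrite leq_pmulr.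
have kx : ga x - x = iter i (horner L) (ga y - y) by rewrite kn ey.
have kx0 : iter n (horner L) (ga x - x) = 0 by rewrite kn xn gal subrr.
apply/eqP; rewrite -subr_eq0; apply/eqP.
rewrite kx -(eventually_periodic_mul n (per _ (kA _ Sy))) addnC iterD -kx.
by rewrite -(subnK nP) iterD kx0 iter_additive0.
Qed.

End CyclicSemiconjugacy.

(** * Rational maps and linearized polynomials *)

Section RationalMaps.
Variable K : closedFieldType.
Implicit Types (f : {fraction {poly K}}) (P : {poly K}).

(** The chosen representative of a fraction has the value of that fraction. *)
Lemma fraction_repr (R : idomainType) (x : {fraction R}) :
  x * FracField.tofrac \d_(repr x) = FracField.tofrac \n_(repr x).
Proof.
rewrite -{1}[x]reprK; set r := repr x; unlock FracField.tofrac.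
rewrite -[LHS]FracField.pi_mul; apply/eqmodP; rewrite /= FracField.equivfE /FracField.mulf.
by rewrite !numden_Ratio ?mulf_neq0 ?oner_eq0 ?denom_ratioP // !mulr1 mulrC.
Qed.

Lemma redgcd_neq0 f : redgcd f != 0.
Proof. by rewrite gcdp_eq0 negb_and denom_ratioP orbT. Qed.

Lemma rnumE f : rnum f * redgcd f = \n_(repr f).
Proof. by rewrite divpK // dvdp_gcdl. Qed.

Lemma rdenE f : rden f * redgcd f = \d_(repr f).
Proof. by rewrite divpK // dvdp_gcdr. Qed.

Lemma rden_neq0 f : rden f != 0.
Proof. by apply: contraNneq (denom_ratioP (repr f)) => e; rewrite -rdenE e mul0r. Qed.

Lemma coprime_rnum_rden f : coprimep (rnum f) (rden f).
Proof. by apply: coprimep_div_gcd; rewrite denom_ratioP orbT. Qed.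

Lemma fraction_rnum f : f * polmap (rden f) = polmap (rnum f).
Proof.
have g0 : polmap (redgcd f) != 0 by rewrite tofrac_eq0 redgcd_neq0.
apply: (mulIf g0); rewrite -mulrA -!tofracM rdenE rnumE; exact: fraction_repr.
Qed.

Lemma polmap_rnum P : rnum (polmap P) = P * rden (polmap P).
Proof.
have /eqP := fraction_rnum (polmap P).
by rewrite -tofracM tofrac_eq => /eqP.
Qed.

(** The reduced denominator divides the numerator, to which it is coprime. *)
Lemma polmap_rden P : size (rden (polmap P)) = 1.
Proof.
apply/eqP; have := coprime_rnum_rden (polmap P); rewrite polmap_rnum.
by rewrite coprimepMl coprimepp => /andP[].
Qed.

Lemma ratmap_polmap P a : ratmap (polmap P) (Some a) = Some P.[a].
Proof.
have /eqP/size_poly1P[k k0 ek] := polmap_rden P.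
by rewrite /= polmap_rnum ek !hornerE (negPf k0) mulfK.
Qed.

Lemma ratmap_polmap_infty P : ratmap (polmap P) None =
  if (1 < size P)%N then None else Some P`_0.
Proof.
have /eqP/size_poly1P[k k0 ek] := polmap_rden P.
rewrite /= polmap_rnum polmap_rden ek mulrC mul_polyC size_scale //.
by case: ifP => // _; rewrite lead_coefC coefZ mulrAC mulfV // mul1r.
Qed.

Lemma iter_polmap P n a : iter n (ratmap (polmap P)) (Some a) = Some (iter n (horner P) a).
Proof. by elim: n => //= n ->; exact: ratmap_polmap. Qed.

Lemma backward_orbit_polmap P a :
  [set x | backward_orbit (polmap P) (Some a) (Some x)]%classic = backward P a.
Proof.
apply/seteqP; split=> x [n]; first by rewrite iter_polmap => -[e]; exists n.
by move=> e; exists n; rewrite iter_polmap e.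
Qed.

Lemma ratmap_pole f a : (ratmap f (Some a) = None) <-> root (rden f) a.
Proof. by rewrite /= /root; case: ifP. Qed.

Lemma polmap_of_no_pole f : (forall a, ratmap f (Some a) <> None) -> exists P, f = polmap P.
Proof.
move=> h; have sd : size (rden f) = 1.
  apply/eqP/negPn/negP => /closed_rootP[a] /ratmap_pole; exact: h.
have /eqP/size_poly1P[k k0 ek] := sd.
exists (k^-1 *: rnum f).
have p0 : polmap (rden f) != 0 by rewrite tofrac_eq0 rden_neq0.
apply: (mulIf p0); rewrite fraction_rnum -tofracM ek mulrC mul_polyC scalerA.
by rewrite mulfV // scale1r.
Qed.

Lemma ratdeg_polmap P : ratdeg (polmap P) = (size P).-1.
Proof.
have /eqP/size_poly1P[k k0 ek] := polmap_rden P.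
rewrite /ratdeg polmap_rden polmap_rnum ek mulrC mul_polyC size_scale //.
by case: (size P) => [|[|m]].
Qed.

Section Poles.
Variables (L : {poly K}) (delta : K) (f : {fraction {poly K}}) (psi : {poly K}).
Let g := L + delta%:P.
Hypotheses (addL : additive_poly L) (L1 : L`_1 != 0) (sL : (2 < size L)%N).
Hypothesis f_deg : (0 < ratdeg f)%N.
Hypothesis semi : forall x : P1 K,
  ratmap f (ratmap (polmap g) x) = ratmap (polmap psi) (ratmap f x).

Let semi_fin x : ratmap f (Some g.[x]) = ratmap (polmap psi) (ratmap f (Some x)).
Proof. by rewrite -semi ratmap_polmap. Qed.

Let sg : (1 < size g)%N.
Proof. by rewrite size_affine // ltnW. Qed.

(** If psi were constant, f would take a single value on the image of g, which is the whole
    affine line. *)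
Lemma semiconj_nonconstant : (1 < size psi)%N.
Proof.
rewrite ltnNge; apply/negP => spsi.
have cst y : ratmap (polmap psi) y = Some psi`_0.
  case: y => [y|]; last by rewrite ratmap_polmap_infty ltnNge spsi.
  by rewrite ratmap_polmap {1}(size1_polyC spsi) hornerC.
have fc y : ratmap f (Some y) = Some psi`_0.
  by have [x <-] := poly_onto y sg; rewrite semi_fin cst.
have [|P eP] := @polmap_of_no_pole f; first by move=> a; rewrite fc.
have PE : P = (psi`_0)%:P.
  apply: poly_ext => x; rewrite hornerC.
  by have := fc x; rewrite eP ratmap_polmap => -[].
move: f_deg; rewrite eP ratdeg_polmap PE.
by have := size_polyC_leq1 psi`_0; case: (size _) => [|[|]].
Qed.

Lemma additive_kernel : exists2 t, t != 0 & L.[t] = 0.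
Proof.
have /factor_theorem[M eM] : root L 0 by rewrite /root additive_poly0.
rewrite subr0 in eM.
have M0 : M != 0 by apply: contraNneq L1 => e; rewrite eM e mul0r coef0.
have sM : size M != 1.
  by apply: contraTneq sL => e; rewrite eM size_mulX // e.
have /closed_rootP[t rt] := sM; exists t; last by rewrite eM hornerM (rootP rt) mul0r.
apply: contraTneq rt => ->; rewrite /root horner_coef0.
by move: L1; rewrite eM coefMX.
Qed.

(** The finite set of poles of f in the affine line is completely invariant under g, which is
    onto; but two poles x and x + t with L(t) = 0 have the same image, so it cannot be finite
    unless it is empty. *)
Lemma semiconj_polynomial : exists P, f = polmap P.
Proof.
apply: polmap_of_no_pole => a0 /ratmap_pole ra0.
have poleP x : root (rden f) g.[x] = root (rden f) x.
  apply/idP/idP => /ratmap_pole h; apply/ratmap_pole.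
    move: h; rewrite semi_fin; case: (ratmap f (Some x)) => // y.
    by rewrite ratmap_polmap.
  by rewrite semi_fin h ratmap_polmap_infty semiconj_nonconstant.
have [rs0 ers0] := poly_roots_seq (rden_neq0 f).
pose rs := undup rs0.
have ers x : (x \in rs) = root (rden f) x by rewrite mem_undup ers0.
have [x ex] := poly_onto a0 sg; have [t t0 Lt] := additive_kernel.
have gt : g.[x + t] = a0 by rewrite -ex !hornerE addL Lt addr0.
have xrs : x \in rs by rewrite ers -poleP ex.
have xtrs : x + t \in rs by rewrite ers -poleP gt.
have sub : {subset rs <= [seq g.[y] | y <- rem x rs]}.
  move=> z; have [y <-] := poly_onto z sg; rewrite ers poleP -ers => yrs.
  have [e|ne] := eqVneq y x; last first.
    by apply: map_f; rewrite mem_rem_uniq ?undup_uniq // inE ne.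
  rewrite e ex -gt; apply: map_f; rewrite mem_rem_uniq ?undup_uniq // inE xtrs andbT.
  by rewrite -subr_eq0 addrAC subrr add0r.
have := uniq_leq_size (undup_uniq rs0) sub.
rewrite size_map size_rem // leqNgt prednK ?leqnn //.
by case: (rs) xrs.
Qed.

End Poles.

End RationalMaps.

Lemma preperiodic_iter (K : closedFieldType) (L : {poly K}) d :
  preperiodic (polmap L) (Some d) ->
  exists i P, (0 < P)%N /\ eventually_periodic (horner L) i P d.
Proof.
move=> /finite_seqP[s es].
apply: (@eventually_periodic_finite _ _ _ (pmap id (s : seq (option K)))) => n.
have : [set` s]%classic (Some (iter n (horner L) d) : P1 K).
  by rewrite -es; exists n => //; exact: iter_polmap.
by rewrite /= => h; rewrite mem_pmap; apply/mapP; exists (Some (iter n (horner L) d)).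
Qed.

Section Linearized.
Variables (K : closedFieldType) (p q r : nat) (c : 'I_r.+1 -> K).
Hypotheses (pK : p \in [pchar K]) (q_pow : p.-nat q) (q_gt1 : (1 < q)%N).
Hypotheses (r_ge1 : (1 <= r)%N) (c_neq0 : c ord0 * c ord_max != 0).
Let L := linearized_poly q c.

Lemma linearized_additive : additive_poly L.
Proof.
move=> x y; rewrite /L /linearized_poly !horner_sum -big_split /=.
apply: eq_bigr => i _; rewrite !hornerE exprDn_pchar ?mulrDr //.
by rewrite (eq_pnat _ (pcharf_eq pK)) pnatX q_pow.
Qed.

Lemma coef_linearized (i : 'I_r.+1) : L`_(q ^ i) = c i.
Proof.
rewrite /L /linearized_poly coef_sum (bigD1 i) //= coefZ coefXn eqxx mulr1.
rewrite big1 ?addr0 // => k ki; rewrite coefZ coefXn eqn_exp2l //.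
by rewrite val_eqE eq_sym (negPf ki) mulr0.
Qed.

Lemma linearized_coef1 : L`_1 != 0.
Proof.
have := coef_linearized ord0; rewrite /= expn0 => ->.
by apply: contraNneq c_neq0 => ->; rewrite mul0r.
Qed.

Lemma size_linearized : (2 < size L)%N.
Proof.
have cm : L`_(q ^ r) != 0.
  have := coef_linearized ord_max; rewrite /= => ->.
  by apply: contraNneq c_neq0 => ->; rewrite mulr0.
have lt : (q ^ r < size L)%N.
  by rewrite ltnNge; apply: contraNN cm => /(nth_default 0) ->.
apply: leq_trans lt; rewrite ltnS; apply: (leq_trans q_gt1).
by rewrite -{1}(expn1 q) leq_exp2l.
Qed.

End Linearized.

(** * The main equivalence *)

Lemma poly_over_fixed (E : fieldType) (K : closedFieldType) (j : {rmorphism E -> K}) (P : {poly K}) :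
  poly_over j P -> fixed_poly j P.
Proof. by move=> [P0 ->] s fs; exact: fixes_map_poly. Qed.

(** Cross-multiplying by the denominator over E determines P. *)
Lemma rat_over_fixed (E : fieldType) (K : closedFieldType) (j : {rmorphism E -> K}) (P : {poly K}) :
  rat_over j (polmap P) -> fixed_poly j P.
Proof.
move=> [p0 [q0 [q0_neq0 e]]] s fs.
have mq0 : map_poly j q0 != 0 by rewrite map_poly_eq0.
have eP : P * map_poly j q0 = map_poly j p0.
  apply/eqP; rewrite -tofrac_eq tofracM -/(polmap P) e divfK //.
  by rewrite tofrac_eq0.
apply: (mulIf mq0); rewrite eP -[in LHS](fixes_map_poly q0 fs) -rmorphM /= eP.
exact: fixes_map_poly.
Qed.

Theorem theorem7p7
  (Fq : finFieldType) (F : fieldExtType {fraction {poly Fq}})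
  (Fbar : closedFieldType) (iota : {rmorphism F -> Fbar})
  (Fbar_algebraic : forall x : Fbar, algebraicOver iota x)
  (psi : {poly F})
  (r : nat) (c : 'I_r.+1 -> Fbar) (phiT : {poly Fbar})
  (phiT_def : phiT = linearized_poly #|Fq| c)
  (r_ge1 : (1 <= r)%N) (c_neq0 : c ord0 * c ord_max != 0)
  (delta : Fbar) (delta_preper : preperiodic (polmap phiT) (Some delta))
  (f : {fraction {poly Fbar}}) (f_deg : (0 < ratdeg f)%N)
  (semiconj : forall x : P1 Fbar,
     ratmap f (ratmap (polmap (phiT + delta%:P)) x)
     = ratmap (polmap (map_poly iota psi)) (ratmap f x))
  (alpha : Fbar) (alpha_not_pole : ratmap f (Some alpha) <> None)
  (beta : P1 Fbar) (beta_def : beta = ratmap f (Some alpha))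
  (E : fieldExtType F) (j : {rmorphism E -> Fbar})
  (j_over_F : forall x : F, j x%:A = iota x)
  (phiT_over : poly_over j phiT) (f_over : rat_over j f)
  (delta_over : point_over j delta) (alpha_over : point_over j alpha) :
  [<-> virtually_abelian (Ginfty j (polmap phiT) (Some alpha));
       virtually_abelian (Ginfty j (polmap (phiT + delta%:P)) (Some alpha));
       virtually_abelian
         (Ginfty j (polmap (map_poly iota psi)) beta)].
Proof.
have iotaE (q : {poly F}) : map_poly iota q = map_poly j (map_poly (in_alg E) q).
  by rewrite -map_poly_comp; apply: eq_map_poly => x /=; rewrite j_over_F.
have algE x : exists2 q : {poly E}, q != 0 & root (map_poly j q) x.
  have [q q0 rq] := Fbar_algebraic x; exists (map_poly (in_alg E) q).
    by rewrite map_poly_eq0.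
  by rewrite -iotaE.
have [p p_pr pFq] := finPcharP Fq.
have pK : p \in [pchar Fbar].
  apply: (rmorph_pchar iota); apply: (rmorph_pchar (in_alg F)).
  apply: (rmorph_pchar (@FracField.tofrac {poly Fq})).
  exact: (rmorph_pchar (@polyC Fq)).
have q_pow : p.-nat #|Fq|.
  have -> : #|Fq| = (p ^ logn p #|Fq|)%N by exact: (card_pprimeChar pFq).
  by rewrite pnatX pnat_id.
have q_gt1 : (1 < #|Fq|)%N by exact: finNzRing_gt1.
have addL : additive_poly phiT by rewrite phiT_def; exact: (linearized_additive c pK q_pow).
have L1 : phiT`_1 != 0 by rewrite phiT_def; exact: linearized_coef1.
have sL : (2 < size phiT)%N by rewrite phiT_def; exact: size_linearized.
have [P eP] := semiconj_polynomial addL L1 sL f_deg semiconj.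
have ffP : fixed_poly j P by apply: rat_over_fixed; rewrite -eP.
have fL : fixed_poly j phiT := poly_over_fixed phiT_over.
have fdelta : fixed_point j delta by case: delta_over => e -> s fs; exact: fs.
have falpha : fixed_point j alpha by case: alpha_over => e -> s fs; exact: fs.
have fg : fixed_poly j (phiT + delta%:P).
  by move=> s fs; rewrite rmorphD /= map_polyC /= fL // fdelta.
have fpsi : fixed_poly j (map_poly iota psi).
  by apply: poly_over_fixed; exists (map_poly (in_alg E) psi); rewrite -iotaE.
have fbeta : fixed_point j P.[alpha].
  by move=> s fs; rewrite (fixed_horner _ (ffP s fs)) falpha.
have semiP : P \Po (phiT + delta%:P) = map_poly iota psi \Po P.
  apply: poly_ext => x; have := semiconj (Some x).
  by rewrite eP !ratmap_polmap !horner_comp => -[].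
have sP : (1 < size P)%N.
  by move: f_deg; rewrite eP ratdeg_polmap; case: (size P) => [|[|]].
have [A [a [b' [b [e [L' [d' [[addA sA a0 e0] [addL' L'1 ePA eA]]]]]]]]] :=
  semiconjugacy_structure pK sP addL L1 sL semiP.
have per : exists i Q, (0 < Q)%N /\ eventually_periodic (horner phiT) i Q delta.
  exact: preperiodic_iter.
have crit h x : fixed_poly j h -> fixed_point j x ->
    virtually_abelian (Ginfty j (polmap h) (Some x)) <->
    virtually_commuting j (backward h x).
  move=> fh fx; rewrite /Ginfty backward_orbit_polmap.
  by apply: virtually_abelianP => //; exact: backward_stable.
have -> : beta = Some P.[alpha] by rewrite beta_def eP ratmap_polmap.
have c1 := crit _ _ fL falpha; have c2 := crit _ _ fg falpha.
have c3 := crit _ _ fpsi fbeta.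
tfae.
- move=> /c1 h; apply/c2.
  rewrite -[delta]add0r; apply: (backward_translate pK) => //.
  by rewrite addr0.
- move=> /c2 h; apply/c3.
  exact: (virtually_commuting_push addL sL ffP semiP addA sA a0 e0 addL' L'1 ePA eA h).
- move=> /c3 h; apply/c1.
  have h2 : virtually_commuting j (backward (phiT + delta%:P) alpha).
    exact: (virtually_commuting_lift algE addL sL fg ffP falpha semiP addA sA a0 e0 addL' L'1 ePA eA h).
  rewrite -[phiT]addr0 -[0]/((0 : Fbar)%:P) -(subrr delta).
  apply: (backward_translate pK) => //.
  have [i [Q [Q0 pQ]]] := per; exists i, Q; split=> //.
  by rewrite /eventually_periodic !iter_additiveN // pQ.
Qed.
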